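(* Let $L\ge1$, let $\boldsymbol x=(x^1,\dots,x^L)$ be the set of variables of $\mathcal B^{\times L}$ and set $e_i^c(\boldsymbol x)=(y^1,\dots,y^L)$. Then for every $0\le i\le n$, $$M(y^1,z)\cdots M(y^L,z)=G_i\!\left(\frac{c-1}{z^{\delta_{i0}}\varepsilon_i(\boldsymbol x)}\right)M(x^1,z)\cdots M(x^L,z)\,G_i\!\left(\frac{c^{-1}-1}{z^{\delta_{i0}}\varphi_i(\boldsymbol x)}\right).$$
   Context: Let $n\ge 4$. Variables are real; all maps and identities are rational (identities hold wherever both sides are defined); $c$ is a parameter, $z$ the spectral parameter; $\delta_{ij}$ is the Kronecker delta; empty products are $1$. **The geometric $D^{(1)}_n$-crystal $\mathcal B$.** Variables $x=(x_1,\dots,x_n,\bar x_{n-1},\dots,\bar x_1)$. Functions: $\varepsilon_0(x)=x_1(\frac{x_2}{\bar x_2}+1)$, $\varphi_0(x)=\bar x_1(\frac{\bar x_2}{x_2}+1)$; $\varepsilon_i(x)=\bar x_i(\frac{x_{i+1}}{\bar x_{i+1}}+1)$, $\varphi_i(x)=x_i(\frac{\bar x_{i+1}}{x_{i+1}}+1)$ for $1\le i\le n-2$; $\varepsilon_{n-1}(x)=x_n\bar x_{n-1}$, $\varphi_{n-1}(x)=x_{n-1}$; $\varepsilon_n(x)=\bar x_{n-1}$, $\varphi_n(x)=x_{n-1}x_n$. With $\xi_i=\frac{x_i+c\bar x_i}{x_i+\bar x_i}$, the map $e_i^c$ changes only the listed coordinates: $e_0^c$: $x_1\mapsto\xi_2^{-1}x_1$,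 $x_2\mapsto c^{-1}\xi_2x_2$, $\bar x_2\mapsto\xi_2\bar x_2$, $\bar x_1\mapsto c\xi_2^{-1}\bar x_1$; $e_i^c$ ($1\le i\le n-2$): $x_i\mapsto c\xi_{i+1}^{-1}x_i$, $x_{i+1}\mapsto c^{-1}\xi_{i+1}x_{i+1}$, $\bar x_{i+1}\mapsto\xi_{i+1}\bar x_{i+1}$, $\bar x_i\mapsto\xi_{i+1}^{-1}\bar x_i$; $e_{n-1}^c$: $x_{n-1}\mapsto cx_{n-1}$, $x_n\mapsto c^{-1}x_n$; $e_n^c$: $x_n\mapsto cx_n$, $\bar x_{n-1}\mapsto c^{-1}\bar x_{n-1}$. The level is $\ell(x)=x_1\cdots x_n\bar x_{n-1}\cdots\bar x_1$. **Product $\mathcal B^{\times L}$.** Variables $\boldsymbol x=(x^1,\dots,x^L)$, each $x^l$ a set of variables of $\mathcal B$. $$\varepsilon_i(\boldsymbol x)=\frac{\sum_{k=1}^L\prod_{j=1}^k\varepsilon_i(x^j)\prod_{j=k}^{L-1}\varphi_i(x^j)}{\prod_{j=1}^{L-1}\varphi_i(x^j)},\quad \varphi_i(\boldsymbol x)=\frac{\sum_{k=1}^L\prod_{j=2}^k\varepsilon_i(x^j)\prod_{j=k}^{L}\varphi_i(x^j)}{\prod_{j=2}^{L}\varepsilon_i(x^j)},$$ $e_i^c(\boldsymbol x)=(e_i^{c_1}(x^1),\dots,e_i^{c_L}(x^L))$ with $$c_l=\frac{\sum_{k=1}^Lc^{\theta(k\le l)}\prod_{j=2}^k\varepsilon_i(x^j)\prod_{j=k}^{L-1}\varphi_i(x^j)}{\sum_{k=1}^Lc^{\theta(k\le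 l-1)}\prod_{j=2}^k\varepsilon_i(x^j)\prod_{j=k}^{L-1}\varphi_i(x^j)},$$ where $\theta(s)=1$ if $s$ is true and $0$ otherwise. **The matrices $G_i(a)$.** $E$ is the $2n\times2n$ identity, $E_{ij}$ matrix units. $G_i(a)=E+a(E_{i,i+1}+E_{2n-i,2n+1-i})$ for $1\le i\le n-1$, $G_n(a)=E+a(E_{n-1,n+1}+E_{n,n+2})$, $G_0(a)=E+a(E_{2n-1,1}+E_{2n,2})$. **The $2n\times 2n$ matrix $M(x,z)$.** Write $M_{i,j}=M(x,z)_{i,j}$, $\ell=\ell(x)$, $\bar X_i=1+\bar x_i/x_i$. First column: $M_{1,1}=x_1/\bar x_1$; $M_{i,1}=x_1\cdots x_{i-1}(1+x_i/\bar x_i)$ for $2\le i\le n-1$; $M_{n,1}=x_1\cdots x_n$; $M_{n+1,1}=x_1\cdots x_{n-1}$; $M_{i,1}=\ell/(\bar x_1\cdots\bar x_{2n-i})$ for $n+2\le i\le 2n$. Other columns ($1\le i\le 2n$): $M_{i,j+1}=\frac{M_{i,j}}{x_j}+(\ell z-1)\big(\frac{\delta_{i,j}}{\bar x_j}+\delta_{i,j+1}\big)$ for $1\le j\le n-2$; $M_{i,n}=\frac{M_{i,n-1}}{x_{n-1}}+(\ell z-1)\big(\frac{\delta_{i,n-1}}{\bar x_{n-1}}+\delta_{i,n+1}\big)$; $M_{i,n+1}=\frac{M_{i,n-1}}{x_{n-1}x_n}+(\ell z-1)\big(\frac{\delta_{i,n-1}}{\bar x_{n-1}x_n}+\delta_{i,n}\big)$;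 $M_{i,2n}=z\frac{\bar x_1}{x_1}M_{i,1}+\delta_{i,2n}\frac{\bar x_1}{x_1}(1-\ell z)+\delta_{i,1}z(\ell z-1)$; $M_{i,2n-1}=z\bar x_1\bar X_2M_{i,1}+(1-\ell z)\big(\delta_{i,2n}\bar x_1\bar X_2+\delta_{i,2n-1}\frac{\bar x_2}{x_2}\big)$; $M_{i,2n-j}=\bar x_j\frac{\bar X_{j+1}}{\bar X_j}M_{i,2n+1-j}+(1-\ell z)\big(\delta_{i,2n+1-j}\bar x_j\frac{\bar X_{j+1}}{\bar X_j}+\delta_{i,2n-j}\frac{\bar x_{j+1}}{x_{j+1}}\big)$ for $2\le j\le n-2$. *)

(* Defs.v *)
From HB Require Import structures.
From mathcomp Require Import all_boot all_order all_algebra.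
From mathcomp Require Export reals.

Set Implicit Arguments.
Unset Strict Implicit.
Unset Printing Implicit Defensive.

Import GRing.Theory.
Local Open Scope ring_scope.

(* Numbering conventions.  The coordinates x_i, xbar_i, the crystal indices   *)
(* 0 <= i <= n and the matrix positions are natural numbers numbered as in    *)
(* the mathematical text (coordinates and matrix positions start at 1).  Only *)
(* the factors x^1, ..., x^L of the product crystal are shifted: they are     *)
(* indexed by 'I_L, so that x^l is [x] at the ordinal of value l - 1.         *)

Record crystal (R : Type) (n : nat) := Crystal {
  unbarred : n.-tuple R;    (* (x_1, ..., x_n) *)
  barred   : n.-1.-tuple R  (* (xbar_1, ..., xbar_(n-1)) *)
}.

Definition xc {R : fieldType} {n} (p : crystal R n) (i : nat) : R :=
  nth 0 (unbarred p) i.-1.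
Definition xb {R : fieldType} {n} (p : crystal R n) (i : nat) : R :=
  nth 0 (barred p) i.-1.

Definition mk_crystal {R : fieldType} (n : nat) (f g : nat -> R) : crystal R n :=
  Crystal [tuple f i.+1 | i < n] [tuple g i.+1 | i < n.-1].

Definition eps {R : fieldType} {n} (i : nat) (p : crystal R n) : R :=
  if i == 0%N then xc p 1 * (xc p 2 / xb p 2 + 1)
  else if (i <= n - 2)%N then xb p i * (xc p i.+1 / xb p i.+1 + 1)
  else if i == (n - 1)%N then xc p n * xb p (n - 1)
  else xb p (n - 1).

Definition phi {R : fieldType} {n} (i : nat) (p : crystal R n) : R :=
  if i == 0%N then xb p 1 * (xb p 2 / xc p 2 + 1)
  else if (i <= n - 2)%N then xc p i * (xb p i.+1 / xc p i.+1 + 1)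
  else if i == (n - 1)%N then xc p (n - 1)
  else xc p (n - 1) * xc p n.

Definition xi {R : fieldType} {n} (c : R) (p : crystal R n) (i : nat) : R :=
  (xc p i + c * xb p i) / (xc p i + xb p i).

Definition e_act {R : fieldType} {n} (i : nat) (c : R) (p : crystal R n) :
    crystal R n :=
  if i == 0%N then
    mk_crystal n
      (fun j => if j == 1%N then (xi c p 2)^-1 * xc p 1
                else if j == 2%N then c^-1 * xi c p 2 * xc p 2
                else xc p j)
      (fun j => if j == 2%N then xi c p 2 * xb p 2
                else if j == 1%N then c * (xi c p 2)^-1 * xb p 1
                else xb p j)
  else if (i <= n - 2)%N then
    mk_crystal n
      (fun j => if j == i then c * (xi c p i.+1)^-1 * xc p i
                else if j == i.+1 then c^-1 * xi c p i.+1 * xc p i.+1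
                else xc p j)
      (fun j => if j == i.+1 then xi c p i.+1 * xb p i.+1
                else if j == i then (xi c p i.+1)^-1 * xb p i
                else xb p j)
  else if i == (n - 1)%N then
    mk_crystal n
      (fun j => if j == (n - 1)%N then c * xc p (n - 1)
                else if j == n then c^-1 * xc p n
                else xc p j)
      (fun j => xb p j)
  else
    mk_crystal n
      (fun j => if j == n then c * xc p n else xc p j)
      (fun j => if j == (n - 1)%N then c^-1 * xb p (n - 1) else xb p j).

Definition level {R : fieldType} {n} (p : crystal R n) : R :=
  (\prod_(1 <= i < n.+1) xc p i) * (\prod_(1 <= i < n) xb p i).

(* Below, with k, j, l of 'I_L standing for the 1-based k + 1, j + 1, l + 1,  *)
(* the range 2 <= j <= k reads 0 < j <= k, the range k <= j <= L - 1 reads    *)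
(* k <= j and j.+1 < L, and the condition k <= l - 1 reads k < l.             *)

Definition eps_prod {R : fieldType} {n L} (i : nat) (x : 'I_L -> crystal R n) : R :=
  (\sum_(k < L) (\prod_(j < L | (j <= k)%N) eps i (x j)) *
                (\prod_(j < L | (k <= j)%N && (j.+1 < L)%N) phi i (x j)))
  / (\prod_(j < L | (j.+1 < L)%N) phi i (x j)).

Definition phi_prod {R : fieldType} {n L} (i : nat) (x : 'I_L -> crystal R n) : R :=
  (\sum_(k < L) (\prod_(j < L | (0 < j <= k)%N) eps i (x j)) *
                (\prod_(j < L | (k <= j)%N) phi i (x j)))
  / (\prod_(j < L | (0 < j)%N) eps i (x j)).

Definition cfactor_num {R : fieldType} {n L} (i : nat) (c : R)
    (x : 'I_L -> crystal R n) (l : 'I_L) : R :=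
  \sum_(k < L) c ^+ (k <= l)%N *
    (\prod_(j < L | (0 < j <= k)%N) eps i (x j)) *
    (\prod_(j < L | (k <= j)%N && (j.+1 < L)%N) phi i (x j)).

Definition cfactor_den {R : fieldType} {n L} (i : nat) (c : R)
    (x : 'I_L -> crystal R n) (l : 'I_L) : R :=
  \sum_(k < L) c ^+ (k < l)%N *
    (\prod_(j < L | (0 < j <= k)%N) eps i (x j)) *
    (\prod_(j < L | (k <= j)%N && (j.+1 < L)%N) phi i (x j)).

Definition cfactor {R : fieldType} {n L} (i : nat) (c : R)
    (x : 'I_L -> crystal R n) (l : 'I_L) : R :=
  cfactor_num i c x l / cfactor_den i c x l.

Definition e_prod {R : fieldType} {n L} (i : nat) (c : R)
    (x : 'I_L -> crystal R n) : 'I_L -> crystal R n :=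
  fun l => e_act i (cfactor i c x l) (x l).

(* The matrix unit E_(a,b), with 1-based positions. *)
Definition Eunit {R : fieldType} (m a b : nat) : 'M[R]_m :=
  \matrix_(r, s) ((r.+1 == a) && (s.+1 == b))%:R.

Definition Gmat {R : fieldType} (n i : nat) (a : R) : 'M[R]_(2 * n) :=
  if i == 0%N then
    1%:M + a *: (Eunit _ (2 * n - 1) 1 + Eunit _ (2 * n) 2)
  else if (i <= n - 1)%N then
    1%:M + a *: (Eunit _ i i.+1 + Eunit _ (2 * n - i) (2 * n + 1 - i))
  else
    1%:M + a *: (Eunit _ (n - 1) (n + 1) + Eunit _ n (n + 2)).

Definition kdelta {R : fieldType} (i j : nat) : R := (i == j)%:R.

Definition Xbar {R : fieldType} {n} (p : crystal R n) (i : nat) : R :=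
  1 + xb p i / xc p i.

Definition Mcol1 {R : fieldType} {n} (p : crystal R n) (i : nat) : R :=
  if i == 1%N then xc p 1 / xb p 1
  else if (i <= n - 1)%N then
    (\prod_(1 <= k < i) xc p k) * (1 + xc p i / xb p i)
  else if i == n then \prod_(1 <= k < n.+1) xc p k
  else if i == (n + 1)%N then \prod_(1 <= k < n) xc p k
  else level p / \prod_(1 <= k < (2 * n - i).+1) xb p k.

(* M_(i,j) for 1 <= j <= n - 1; the value at j = 0 is never used. *)
Fixpoint Mlow {R : fieldType} {n} (p : crystal R n) (z : R) (i j : nat) : R :=
  match j with
  | 0 => 0
  | 1 => Mcol1 p i
  | j'.+1 => Mlow p z i j' / xc p j'
             + (level p * z - 1) * (kdelta i j' / xb p j' + kdelta i j'.+1)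
  end.

(* M_(i,2n-j) for 0 <= j <= n - 2. *)
Fixpoint Mhigh {R : fieldType} {n} (p : crystal R n) (z : R) (i j : nat) : R :=
  match j with
  | 0 => z * (xb p 1 / xc p 1) * Mcol1 p i
         + kdelta i (2 * n) * (xb p 1 / xc p 1) * (1 - level p * z)
         + kdelta i 1 * z * (level p * z - 1)
  | 1 => z * xb p 1 * Xbar p 2 * Mcol1 p i
         + (1 - level p * z) * (kdelta i (2 * n) * xb p 1 * Xbar p 2
                                + kdelta i (2 * n - 1) * (xb p 2 / xc p 2))
  | j'.+1 =>
      xb p j * (Xbar p j.+1 / Xbar p j) * Mhigh p z i j'
      + (1 - level p * z)
        * (kdelta i (2 * n + 1 - j) * xb p j * (Xbar p j.+1 / Xbar p j)
           + kdelta i (2 * n - j) * (xb p j.+1 / xc p j.+1))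
  end.

Definition Mentry {R : fieldType} {n} (p : crystal R n) (z : R) (i j : nat) : R :=
  if (j <= n - 1)%N then Mlow p z i j
  else if j == n then
    Mlow p z i (n - 1) / xc p (n - 1)
    + (level p * z - 1) * (kdelta i (n - 1) / xb p (n - 1) + kdelta i (n + 1))
  else if j == (n + 1)%N then
    Mlow p z i (n - 1) / (xc p (n - 1) * xc p n)
    + (level p * z - 1) * (kdelta i (n - 1) / (xb p (n - 1) * xc p n)
                           + kdelta i n)
  else Mhigh p z i (2 * n - j).

Definition Mmat {R : fieldType} {n} (p : crystal R n) (z : R) : 'M[R]_(2 * n) :=
  \matrix_(i, j) Mentry p z i.+1 j.+1.

Definition Mprod {R : fieldType} {n L} (x : 'I_L -> crystal R n) (z : R) :
    'M[R]_(2 * n) :=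
  \big[mulmx/1%:M]_(l < L) Mmat (x l) z.

(* Domains of definition.  Division is total in the library (a / 0 = 0), so   *)
(* "wherever both sides are defined" is expressed by the nonvanishing of      *)
(* exactly those quantities by which the formulas above divide.               *)

Definition Mmat_defined {R : fieldType} {n} (p : crystal R n) : Prop :=
  [/\ forall i, (1 <= i <= n)%N -> xc p i != 0,
      forall i, (1 <= i <= n - 1)%N -> xb p i != 0
    & forall i, (2 <= i <= n - 2)%N -> Xbar p i != 0].

Definition e_act_defined {R : fieldType} {n} (i : nat) (c : R)
    (p : crystal R n) : Prop :=
  c != 0 /\
  ((i <= n - 2)%N ->
    let k := if i == 0%N then 2%N else i.+1 in
    xc p k + xb p k != 0 /\ xi c p k != 0).

(* The divisions inside eps and phi are by coordinates xc, xb with indices    *)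
(* 2, ..., n - 1, which rhs_defined already requires to be nonzero.           *)
Definition lhs_defined {R : fieldType} {n L} (i : nat) (c : R)
    (x : 'I_L -> crystal R n) : Prop :=
  forall l : 'I_L,
    [/\ cfactor_den i c x l != 0,
        e_act_defined i (cfactor i c x l) (x l)
      & Mmat_defined (e_prod i c x l)].

Definition rhs_defined {R : fieldType} {n L} (i : nat) (c z : R)
    (x : 'I_L -> crystal R n) : Prop :=
  [/\ forall l : 'I_L, Mmat_defined (x l),
      c != 0,
      (\prod_(j < L | (j.+1 < L)%N) phi i (x j) != 0)
        /\ (\prod_(j < L | (0 < j)%N) eps i (x j) != 0),
      z ^+ (i == 0%N) * eps_prod i x != 0
    & z ^+ (i == 0%N) * phi_prod i x != 0].

(* Main.v *)
Require Import Defs.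
From mathcomp Require Import all_boot all_order all_algebra reals.
From mathcomp Require Import zify ring.

(** The identity is reduced to a single factor and the factors are then
    chained.

    One factor.  For L = 1 the claim (lemma [Mmat_e_act]) is
      M(e_i^c x) = G_i(a) M(x) G_i(b),
    with a = (c - 1) / (z^delta eps_i) and b = (1/c - 1) / (z^delta phi_i).
    A row of M(x) is determined by its first entry s and by the row d of the
    identity matrix at the same position: starting from s, two linear
    recursions produce the columns 1, 2, ..., n+1 and the columns
    2n, 2n-1, ..., n+2, and d is their source term.  The recursions are linear
    in the pair (s, d), so a row of G_i(a) M(x) comes out of the same
    recursions, applied to the pair that results from the row operation on the
    first column and on the identity matrix.  The claim thereby becomes a
    comparison, one row at a time, of two runs of the recursions, one with the
    coordinates of e_i^c x and one with those of x and the modified data.  The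
    coordinates and the source terms differ only near two columns; there the
    two runs separate by b times the neighbouring column, which is the column
    operation G_i(b), and they meet again one step later.  Away from these
    places they satisfy the same recursion.  The meeting is a rational identity
    that involves at most four coordinates.

    Two points are not local.  The first columns must match, which follows from
    their product formulas ([first_column_affine], [first_column_mid],
    [first_column_penult], [first_column_final]).  For i = n-1 and i = n the
    column n+2 at the end of one recursion receives a multiple of the column
    n+1 or n at the end of the other; the two ends are linked by the relation
    [hinge], a consequence of the closed forms of both recursions.

    Chaining.  The factors c_l are quotients N_l / D_l with N_l = D_(l+1), and
    N_l - D_l is c - 1 times the l-th term of the sum D_1, which is up to
    normalisation the sum defining eps_i and phi_i.  Hence the matrix to the
    right of the l-th factor is the inverse of the matrix to the left of the
    next one, as G_i(a) G_i(b) = G_i(a + b), and only the two outer matrices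
    survive.  Their arguments are those of the product crystal. *)

Set Implicit Arguments.
Unset Strict Implicit.
Unset Printing Implicit Defensive.

Import GRing.Theory.
Local Open Scope ring_scope.

(** * Indices and products *)

(** Hypotheses about field elements are dropped before [lia] is called: the
    preprocessing would otherwise spend most of its time on them. *)
Ltac index_lia :=
  lazymatch goal with
  | |- is_true (negb (@eq_op ?T _ _)) => unify (Equality.sort T) nat
  | |- is_true _ => idtac
  | |- @eq bool _ _ => idtac
  | |- @eq nat _ _ => idtac
  end;
  repeat match goal with
  | H : ?T |- _ =>
    lazymatch T with
    | nat => fail
    | is_true (leq _ _) => fail
    | is_true (andb _ _) => fail
    | is_true (negb (@eq_op ?U _ _)) =>
      tryif unify (Equality.sort U) nat then fail else clear H
    | @eq ?U _ _ => tryif unify U nat then fail else clear H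
    | _ => clear H
    end
  end; lia.

(** The action e_i alters two neighbouring coordinates and multiplies their
    product by a constant, so that longer products change by that constant. *)
Lemma prod_pair (R : fieldType) (f g : nat -> R) u i m : (0 < i)%N -> (i.+1 < m)%N ->
  f i * f i.+1 = u * (g i * g i.+1) ->
  (forall k, (1 <= k < m)%N -> k != i -> k != i.+1 -> f k = g k) ->
  \prod_(1 <= k < m) f k = u * \prod_(1 <= k < m) g k.
Proof.
move=> i0 im fg h.
have split h' : \prod_(1 <= k < m) h' k =
    \prod_(1 <= k < i) h' k * (h' i * h' i.+1 * \prod_(i.+2 <= k < m) h' k) :> R.
  rewrite (big_cat_nat (n := i)) //=; last by index_lia.
  by rewrite (big_ltn (m := i)) ?(big_ltn (m := i.+1)) ?mulrA //; index_lia.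
rewrite (split f) (split g).
have -> : \prod_(1 <= k < i) f k = \prod_(1 <= k < i) g k.
  by apply: eq_big_nat => k hk; apply: h; index_lia.
have -> : \prod_(i.+2 <= k < m) f k = \prod_(i.+2 <= k < m) g k.
  by apply: eq_big_nat => k hk; apply: h; index_lia.
by rewrite fg; ring.
Qed.

Lemma prod_recr (R : fieldType) (f : nat -> R) m : (0 < m)%N ->
  \prod_(1 <= k < m.+1) f k = \prod_(1 <= k < m) f k * f m.
Proof. by move=> hm; rewrite big_nat_recr. Qed.

Lemma prod_recr_pred (R : fieldType) (f : nat -> R) m : (1 < m)%N ->
  \prod_(1 <= k < m) f k = \prod_(1 <= k < m - 1) f k * f (m - 1)%N.
Proof. by case: m => // m hm; rewrite subn1 prod_recr. Qed.

Lemma prod_nat_neq0 (R : fieldType) (f : nat -> R) m : (forall k, (1 <= k < m)%N -> f k != 0) ->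
  \prod_(1 <= k < m) f k != 0.
Proof.
elim: m => [|m IH] h; first by rewrite big_geq ?oner_eq0.
case: (posnP m) => [->|m0]; first by rewrite big_geq ?oner_eq0.
rewrite prod_recr //; apply: mulf_neq0; last by apply: h; index_lia.
by apply: IH => k hk; apply: h; index_lia.
Qed.

(** * Rows generated by the column recursions *)

Section Propagation.
Variables (R : fieldType) (n : nat).
Implicit Types (p q : crystal R n) (z w s : R) (d : nat -> R).

(** What the j-th column hands over to column j+1: column j+1 is this value plus
    [w * d j.+1].  The initial value is chosen so that column 1 is [s], which
    puts column 1 on the same footing as the others. *)
Fixpoint low_state p w s d j : R :=
  if j is k.+1 then
    (low_state p w s d k + w * d k.+1) / xc p k.+1 + w * d k.+1 / xb p k.+1
  else s - w * d 1%N.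

(** The recursion for the columns 2n, 2n-1, and so on.  The quotients
    Xbar_(j+1) / Xbar_j in the definition of the matrix telescope: up to source
    terms, column 2n-j is [Xbar p j.+1] times an unknown that is multiplied by
    xbar_j at step j, whence no division occurs. *)
Fixpoint high_state p z w s d j : R :=
  if j is k.+1 then xb p k.+1 * (high_state p z w s d k - w * d (2 * n - k)%N)
  else z * s.

(** The row with first entry [s] and source [d]; [w] stands for [level p * z - 1].
    Taking the source as an arbitrary sequence makes the row operations of
    [Gmat] act on such rows through [s] and [d] alone. *)
Definition row_entry p z w s d j : R :=
  if (j <= n - 1)%N then low_state p w s d j.-1 + w * d j
  else if j == n then low_state p w s d (n - 1) + w * d (n + 1)%N
  else if j == (n + 1)%N then low_state p w s d (n - 1) / xc p n + w * d n
  else if j == (2 * n)%N then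
    xb p 1 / xc p 1 * (high_state p z w s d 0 - w * d (2 * n)%N) + z * w * d 1%N
  else Xbar p (2 * n - j).+1 * (high_state p z w s d (2 * n - j) - w * d j) + w * d j.

Lemma high_stateS p z w s d j :
  high_state p z w s d j.+1 = xb p j.+1 * (high_state p z w s d j - w * d (2 * n - j)%N).
Proof. by []. Qed.

Lemma low_stateE p w s d j : (0 < j)%N ->
  low_state p w s d j = (low_state p w s d j.-1 + w * d j) / xc p j + w * d j / xb p j.
Proof. by case: j. Qed.

Lemma high_stateE p z w s d j : (0 < j)%N ->
  high_state p z w s d j = xb p j * (high_state p z w s d j.-1 - w * d (2 * n - j.-1)%N).
Proof. by case: j. Qed.

Lemma row_entry_low p z w s d j : (j <= n - 1)%N ->
  row_entry p z w s d j = low_state p w s d j.-1 + w * d j.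
Proof. by rewrite /row_entry => ->. Qed.

Lemma row_entry_n p z w s d : (1 < n)%N ->
  row_entry p z w s d n = low_state p w s d (n - 1) + w * d (n + 1)%N.
Proof. by move=> hn; rewrite /row_entry eqxx ifF //; lia. Qed.

Lemma row_entry_n1 p z w s d : (1 < n)%N ->
  row_entry p z w s d (n + 1) = low_state p w s d (n - 1) / xc p n + w * d n.
Proof. by move=> hn; rewrite /row_entry eqxx ifF ?ifF //; lia. Qed.

Lemma row_entry_last p z w s d : (1 < n)%N ->
  row_entry p z w s d (2 * n) =
  xb p 1 / xc p 1 * (high_state p z w s d 0 - w * d (2 * n)%N) + z * w * d 1%N.
Proof. by move=> hn; rewrite /row_entry eqxx 3?ifF //; lia. Qed.

Lemma row_entry_high p z w s d j : (1 <= j <= n - 2)%N ->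
  row_entry p z w s d (2 * n - j) =
  Xbar p j.+1 * (high_state p z w s d j - w * d (2 * n - j)%N) + w * d (2 * n - j)%N.
Proof.
move=> hj; have h : (2 * n - (2 * n - j))%N = j by lia.
by rewrite /row_entry h 4?ifF //; lia.
Qed.

(** Two runs that meet stay together as long as coordinates and sources agree. *)
Lemma low_state_eq p q w s t d e j0 j1 : (j0 <= j1)%N ->
  low_state q w s d j0 = low_state p w t e j0 ->
  (forall k, (j0 < k <= j1)%N -> [/\ xc q k = xc p k, xb q k = xb p k & d k = e k]) ->
  low_state q w s d j1 = low_state p w t e j1.
Proof.
elim: j1 => [|j IH] hj h0 h; first by move: h0; have -> : j0 = 0%N by lia.
case: (ltnP j j0) => hj0; first by have -> : j.+1 = j0 by lia.
have [|h1 h2 h3] := h j.+1; first by lia.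
rewrite /= h1 h2 h3 IH // => k hk; apply: h; lia.
Qed.

Lemma high_state_eq p q z w s t d e j0 j1 : (j0 <= j1)%N ->
  high_state q z w s d j0 = high_state p z w t e j0 ->
  (forall k, (j0 < k <= j1)%N -> xb q k = xb p k /\ d (2 * n - k.-1)%N = e (2 * n - k.-1)%N) ->
  high_state q z w s d j1 = high_state p z w t e j1.
Proof.
elim: j1 => [|j IH] hj h0 h; first by move: h0; have -> : j0 = 0%N by lia.
case: (ltnP j j0) => hj0; first by have -> : j.+1 = j0 by lia.
have [|h1 /= h2] := h j.+1; first by lia.
rewrite /= h1 h2 IH // => k hk; apply: h; lia.
Qed.

(** The nonvanishing of Xbar_2, ..., Xbar_(n-2) lets the quotients
    Xbar_(j+1) / Xbar_j telescope. *)
Lemma Mentry_row_entry p z r j : (4 <= n)%N -> Mmat_defined p -> (1 <= j <= 2 * n)%N ->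
  Mentry p z r j = row_entry p z (level p * z - 1) (Mcol1 p r) (kdelta r) j.
Proof.
move=> hn [hx hb hX] hj; set w := level p * z - 1.
have hl k : (1 <= k)%N -> Mlow p z r k = low_state p w (Mcol1 p r) (kdelta r) k.-1 + w * kdelta r k.
  elim: k => // -[|k] IH _; first by rewrite /=; ring.
  by rewrite [LHS]/= -/(Mlow p z r k.+1) -/w IH //=; ring.
rewrite /Mentry; case: ifP => hj1; first by rewrite row_entry_low // hl //; lia.
have hn1 : (n - 1)%N = (n - 2).+1 by lia.
case: ifP => [/eqP ->|hj2].
  rewrite row_entry_n ?hl //; try lia; rewrite hn1 /= -/w; ring.
case: ifP => [/eqP ->|hj3].
  have x0 : xc p (n-1) != 0 by apply: hx; lia.
  have x1 : xc p n != 0 by apply: hx; lia.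
  have x2 : xb p (n-1) != 0 by apply: hb; lia.
  rewrite row_entry_n1
      ?hl //; try lia; rewrite -/w; move: x0 x1 x2; rewrite hn1 /= => x0 x1 x2; field.
  by rewrite x0 x1 x2.
have hh k : (1 <= k <= n - 2)%N -> Mhigh p z r k =
   Xbar p k.+1 * (high_state p z w (Mcol1 p r) (kdelta r) k - w * kdelta r (2 * n - k)%N)
   + w * kdelta r (2 * n - k)%N.
  have Xk m : xb p m / xc p m = Xbar p m - 1 by rewrite /Xbar; ring.
  elim: k => // -[|k] IH hk.
    have -> : Mhigh p z r 1 = z * xb p 1 * Xbar p 2 * Mcol1 p r
         + (1 - level p * z) * (kdelta r (2 * n) * xb p 1 * Xbar p 2
                                + kdelta r (2 * n - 1) * (xb p 2 / xc p 2)) by [].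
    by rewrite Xk /= subn0 /w; ring.
  have -> : Mhigh p z r k.+2 = xb p k.+2 * (Xbar p k.+3 / Xbar p k.+2) * Mhigh p z r k.+1
      + (1 - level p * z)
        * (kdelta r (2 * n + 1 - k.+2) * xb p k.+2 * (Xbar p k.+3 / Xbar p k.+2)
           + kdelta r (2 * n - k.+2) * (xb p k.+3 / xc p k.+3)) by [].
  have X0 : Xbar p k.+2 != 0 by apply: hX; lia.
  rewrite Xk IH; last by lia.
  have -> : (2 * n + 1 - k.+2)%N = (2 * n - k.+1)%N by lia.
  rewrite (high_stateS _ _ _ _ _ k.+1) /w.
  set h := high_state _ _ _ _ _ _.
  by field.
case: (eqVneq j (2 * n)%N) => [->|hj4].
  rewrite subnn row_entry_last /=; last by lia.
  by rewrite /w /=; ring.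
rewrite hh; last by lia.
rewrite -row_entry_high; last by lia.
by congr row_entry; lia.
Qed.

End Propagation.

(** * The first column and the relation between the two recursions *)

Section SingleFactor.
Variables (R : fieldType) (n : nat).
Hypothesis hn : (4 <= n)%N.
Implicit Types (p q : crystal R n) (z w s a b c : R) (d : nat -> R).

Lemma Mcol1_low p r : (2 <= r <= n - 1)%N ->
  Mcol1 p r = (\prod_(1 <= k < r) xc p k) * (1 + xc p r / xb p r).
Proof. by move=> hr; rewrite /Mcol1 ifF ?ifT //; index_lia. Qed.

Lemma Mcol1_n p : Mcol1 p n = \prod_(1 <= k < n.+1) xc p k.
Proof. by rewrite /Mcol1 eqxx !ifF //; index_lia. Qed.

Lemma Mcol1_n1 p : Mcol1 p (n + 1) = \prod_(1 <= k < n) xc p k.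
Proof. by rewrite /Mcol1 eqxx !ifF //; index_lia. Qed.

Lemma Mcol1_high p k : (k <= n - 2)%N ->
  Mcol1 p (2 * n - k) = level p / \prod_(1 <= m < k.+1) xb p m.
Proof.
move=> hk; rewrite /Mcol1 !ifF; try index_lia.
by have -> : (2 * n - (2 * n - k))%N = k by index_lia.
Qed.

(** Unrolled, the recursion adds w times the first-column entries at the
    positions 1, ..., j of the identity row.  In row [r] this picks up the first
    entry of that very row when r <= j, so the run only rescales it. *)
Lemma low_closed p w r j : Mmat_defined p -> (1 <= r)%N -> (1 <= j <= n - 1)%N ->
  (\prod_(1 <= k < j.+1) xc p k) * low_state p w (Mcol1 p r) (kdelta r) j
  = Mcol1 p r * (1 + w * (r <= j)%N%:R).
Proof.
move=> [hx hb _] hr; elim: j => // j IH hj.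
have x0 : xc p j.+1 != 0 by apply: hx; index_lia.
have b0 : xb p j.+1 != 0 by apply: hb; index_lia.
rewrite prod_recr //=.
case: (posnP j) => [j0|j0].
  move: x0 b0; rewrite j0 => x0 b0; rewrite big_geq //= /kdelta.
  case: (eqVneq r 1%N) => [->|hr1]; last first.
    have -> : (r <= 1)%N = false by index_lia.
    by rewrite /=; field; rewrite x0 b0.
  by rewrite /Mcol1 /=; field; rewrite x0 b0.
set P := \prod_(_ <= _ < _) _ in IH *.
transitivity (P * low_state p w (Mcol1 p r) (kdelta r) j
    + w * kdelta r j.+1 * (P * (1 + xc p j.+1 / xb p j.+1))).
  by field; rewrite x0 b0.
rewrite IH; last by index_lia.
rewrite -Mcol1_low; last by index_lia.
rewrite /kdelta; case: (eqVneq r j.+1) => [->|hr1].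
  by rewrite leqnn ltnn /=; ring.
have -> : (r <= j.+1)%N = (r <= j)%N by index_lia.
by rewrite /=; ring.
Qed.

(** The counterpart of [low_closed]: the positions 2n, ..., 2n-j+1 are visited,
    and the first-column entry at 2n-k is level / (xbar_1 ... xbar_k). *)
Lemma high_closed p z w r j : Mmat_defined p -> (r <= 2 * n)%N -> (j <= n - 1)%N ->
  level p * high_state p z w (Mcol1 p r) (kdelta r) j
  = (\prod_(1 <= k < j.+1) xb p k) * Mcol1 p r * (level p * z - w * (2 * n - j < r)%N%:R).
Proof.
move=> [hx hb _] hr; elim: j => [|j IH] hj.
  rewrite big_geq //= subn0; have -> : (2 * n < r)%N = false by index_lia.
  by rewrite /=; ring.
have P0 : \prod_(1 <= k < j.+1) xb p k != 0.
  by apply: prod_nat_neq0 => k hk; apply: hb; index_lia.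
rewrite prod_recr // high_stateS.
set P := \prod_(_ <= _ < _) _ in IH P0 *.
(* The source term is written as P times the first-column entry at 2n-j. *)
transitivity (xb p j.+1 * (level p * high_state p z w (Mcol1 p r) (kdelta r) j
   - w * kdelta r (2 * n - j) * (P * (level p / P)))).
  by field.
rewrite IH -?Mcol1_high; try index_lia.
rewrite /kdelta; case: (eqVneq r (2 * n - j)%N) => [->|hr1].
  rewrite ltnn (_ : (_ < _)%N = true); first by rewrite /=; ring.
  index_lia.
have -> : (2 * n - j.+1 < r)%N = (2 * n - j < r)%N by index_lia.
by rewrite /=; ring.
Qed.

(** Together the two runs visit every position except n and n+1, each of them
    once.  As [level p * z = w + 1], the closed forms therefore agree, with the
    factor 1 + w in the rows r < n and the factor 1 in the rows r > n+1; in the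
    rows n and n+1 the source terms make up the difference. *)
Lemma hinge p z r : Mmat_defined p -> (1 <= r <= 2 * n)%N ->
  let w := level p * z - 1 in
  xc p n * high_state p z w (Mcol1 p r) (kdelta r) (n - 1)
  = low_state p w (Mcol1 p r) (kdelta r) (n - 1) + w * kdelta r (n + 1)
    + xc p n * (w * kdelta r n).
Proof.
move=> hp hr w; have [hx hb _] := hp.
have := high_closed z w hp (r := r) (j := n - 1) ltac:(index_lia) ltac:(index_lia).
have := low_closed w hp (r := r) (j := n - 1) ltac:(index_lia) ltac:(index_lia).
have -> : (n - 1).+1 = n by index_lia.
set h := high_state _ _ _ _ _ _; set l := low_state _ _ _ _ _.
have P0 : \prod_(1 <= k < n) xc p k != 0 by apply: prod_nat_neq0 => k hk; apply: hx; index_lia.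
have Q0 : \prod_(1 <= k < n) xb p k != 0 by apply: prod_nat_neq0 => k hk; apply: hb; index_lia.
have Mn := Mcol1_n p; have Mn1 := Mcol1_n1 p.
have lv : level p = \prod_(1 <= k < n) xc p k * xc p n * \prod_(1 <= k < n) xb p k.
  by rewrite /level prod_recr //; index_lia.
move: Mn; rewrite prod_recr; last by index_lia.
set P := \prod_(1 <= k < n) xc p k in P0 lv Mn1 *.
set Q := \prod_(1 <= k < n) xb p k in Q0 lv *.
move=> Mn lE hE.
(* After multiplication by x_1 ... x_(n-1) both closed forms apply. *)
apply: (mulfI P0); rewrite !mulrDr lE.
have -> : P * (xc p n * h) = Mcol1 p r * (level p * z - w * (2 * n - (n - 1) < r)%N%:R).
  by apply: (mulfI Q0); rewrite (mulrA Q (Mcol1 p r)) -hE lv; ring.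
have -> : level p * z = w + 1 by rewrite /w; ring.
rewrite /kdelta; case: (eqVneq r n) => [->|rn].
  have -> : (n == n + 1)%N = false by index_lia.
  have -> : (2 * n - (n - 1) < n)%N = false by index_lia.
  have -> : (n <= n - 1)%N = false by index_lia.
  by rewrite Mn /=; ring.
case: (eqVneq r (n + 1)%N) => [->|rn1].
  have -> : (2 * n - (n - 1) < n + 1)%N = false by index_lia.
  have -> : (n + 1 <= n - 1)%N = false by index_lia.
  by rewrite Mn1 /=; ring.
have -> : (2 * n - (n - 1) < r)%N = ~~ (r <= n - 1)%N by index_lia.
by case: (r <= n - 1)%N => /=; ring.
Qed.

(** * Coordinates of the geometric crystal action *)

Lemma xc_mk (f g : nat -> R) k : (1 <= k <= n)%N -> xc (mk_crystal n f g) k = f k.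
Proof.
move=> hk; have hk' : (k.-1 < n)%N by index_lia.
by rewrite /xc /= (nth_mktuple _ 0 (Ordinal hk')) /=; congr f; index_lia.
Qed.

Lemma xb_mk (f g : nat -> R) k : (1 <= k <= n - 1)%N -> xb (mk_crystal n f g) k = g k.
Proof.
move=> hk; have hk' : (k.-1 < n.-1)%N by index_lia.
by rewrite /xb /= (nth_mktuple _ 0 (Ordinal hk')) /=; congr g; index_lia.
Qed.

Lemma e_act_affine c p : let q := e_act 0 c p in let g := xi c p 2 in
  [/\ xc q 1 = g^-1 * xc p 1 /\ xb q 1 = c * g^-1 * xb p 1,
      xc q 2 = c^-1 * g * xc p 2 /\ xb q 2 = g * xb p 2,
      forall k, (3 <= k <= n)%N -> xc q k = xc p k
    & forall k, (3 <= k <= n - 1)%N -> xb q k = xb p k].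
Proof.
rewrite /e_act /=; split; [split|split| |]; rewrite ?xc_mk ?xb_mk //; try index_lia.
  by move=> [|[|[|k]]] // hk; rewrite xc_mk.
by move=> [|[|[|k]]] // hk; rewrite xb_mk.
Qed.

Lemma e_act_mid i c p : (i < n - 2)%N ->
  let q := e_act i.+1 c p in let g := xi c p i.+2 in
  [/\ xc q i.+1 = c * g^-1 * xc p i.+1 /\ xb q i.+1 = g^-1 * xb p i.+1,
      xc q i.+2 = c^-1 * g * xc p i.+2 /\ xb q i.+2 = g * xb p i.+2,
      forall k, (1 <= k <= n)%N -> k != i.+1 -> k != i.+2 -> xc q k = xc p k
    & forall k, (1 <= k <= n - 1)%N -> k != i.+1 -> k != i.+2 -> xb q k = xb p k].
Proof.
move=> hi; have ne : (i.+2 == i.+1) = false by index_lia.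
have ne' : (i.+1 == i.+2) = false by index_lia.
rewrite /e_act /= hi; split; [split|split| |].
- by rewrite xc_mk ?eqxx //; index_lia.
- by rewrite xb_mk ?eqxx ?ne' //; index_lia.
- by rewrite xc_mk ?eqxx ?ne //; index_lia.
- by rewrite xb_mk ?eqxx //; index_lia.
- by move=> k hk /negPf h1 /negPf h2; rewrite xc_mk ?h1 ?h2.
- by move=> k hk /negPf h1 /negPf h2; rewrite xb_mk ?h1 ?h2.
Qed.

Lemma e_act_penult c p : let q := e_act (n - 1) c p in
  [/\ xc q (n - 1) = c * xc p (n - 1), xc q n = c^-1 * xc p n,
      forall k, (1 <= k <= n - 2)%N -> xc q k = xc p k
    & forall k, (1 <= k <= n - 1)%N -> xb q k = xb p k].
Proof.
have h0 : (n - 1 == 0)%N = false by index_lia.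
have h1 : (n - 1 <= n - 2)%N = false by index_lia.
rewrite /e_act h0 h1 eqxx.
have ne : (n == n - 1)%N = false by index_lia.
split.
- by rewrite xc_mk ?eqxx //; index_lia.
- by rewrite xc_mk ?ne ?eqxx //; index_lia.
- by move=> k hk; rewrite xc_mk ?ifF //; index_lia.
- by move=> k hk; rewrite xb_mk.
Qed.

Lemma e_act_final c p : let q := e_act n c p in
  [/\ xc q n = c * xc p n, xb q (n - 1) = c^-1 * xb p (n - 1),
      forall k, (1 <= k <= n - 1)%N -> xc q k = xc p k
    & forall k, (1 <= k <= n - 2)%N -> xb q k = xb p k].
Proof.
have h0 : (n == 0)%N = false by index_lia.
have h1 : (n <= n - 2)%N = false by index_lia.
have h2 : (n == n - 1)%N = false by index_lia.
rewrite /e_act h0 h1 h2.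
split.
- by rewrite xc_mk ?eqxx //; index_lia.
- by rewrite xb_mk ?eqxx //; index_lia.
- by move=> k hk; rewrite xc_mk ?ifF //; index_lia.
- by move=> k hk; rewrite xb_mk ?ifF //; index_lia.
Qed.

(** * The first column under the action *)

(** In the affine case the column operation reaches column 1: it adds [b] times
    column 2n-1, which is written here through its expression in terms of
    column 1 because the recursions have to be started from the new value.
    Rows other than 2n-1 and 2n are multiplied by 1/c. *)
Lemma first_column_affine p z a b c r :
  Mmat_defined p -> c != 0 -> z != 0 ->
  xc p 2 + xb p 2 != 0 -> xc p 2 + c * xb p 2 != 0 ->
  let q := e_act 0 c p in let w := level p * z - 1 in
  a = (c - 1) / (z * (xc p 1 * (xc p 2 / xb p 2 + 1))) ->
  b = (c^-1 - 1) / (z * (xb p 1 * (xb p 2 / xc p 2 + 1))) ->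
  let s := Mcol1 p r + a * ((r == 2 * n - 1)%N%:R * Mcol1 p 1 + (r == 2 * n)%N%:R * Mcol1 p 2) in
  (1 <= r <= 2 * n)%N ->
  level q = level p /\
  Mcol1 q r = s + b * ((1 + xb p 2 / xc p 2) *
    (xb p 1 * (z * s - w * kdelta r (2 * n)) - w * kdelta r (2 * n - 1))
        + w * kdelta r (2 * n - 1)).
Proof.
move=> hp c0 z0 nz1 nz2 q w aE bE s hr; have [hx hb _] := hp.
have [] := e_act_affine c p; rewrite -/q; set g := xi c p 2.
have gE : g = (xc p 2 + c * xb p 2) / (xc p 2 + xb p 2) by [].
clearbody g q => -[qx qb] [qx1 qb1] qx' qb'.
have x0 : xc p 1 != 0 by apply: hx; index_lia.
have b0 : xb p 1 != 0 by apply: hb; index_lia.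
have x1 : xc p 2 != 0 by apply: hx; index_lia.
have b1 : xb p 2 != 0 by apply: hb; index_lia.
have PX m : (2 < m <= n.+1)%N -> \prod_(1 <= k < m) xc q k = c^-1 * \prod_(1 <= k < m) xc p k.
  move=> hm; apply: (prod_pair (i := 1)); try index_lia.
    rewrite qx qx1 gE; field; by rewrite ?c0 ?nz1 ?nz2.
  by move=> k hk h1 h2; apply: qx'; index_lia.
have PB m : (2 < m <= n)%N -> \prod_(1 <= k < m) xb q k = c * \prod_(1 <= k < m) xb p k.
  move=> hm; apply: (prod_pair (i := 1)); try index_lia.
    rewrite qb qb1 gE; field; by rewrite ?nz1 ?nz2.
  by move=> k hk h1 h2; apply: qb'; index_lia.
have lv : level q = level p.
  rewrite /level PX ?PB; try index_lia; field; exact: c0.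
split=> //.
have P0 m : (m <= n)%N -> \prod_(1 <= k < m) xb p k != 0.
  by move=> hm; apply: prod_nat_neq0 => k hk; apply: hb; index_lia.
have M1 (t : crystal R n) : Mcol1 t 1 = xc t 1 / xb t 1 by [].
have M2 (t : crystal R n) : Mcol1 t 2 = xc t 1 * (1 + xc t 2 / xb t 2).
  by rewrite Mcol1_low ?big_nat1 //; index_lia.
case: (eqVneq r (2 * n)%N) => [rE|r1].
  rewrite /s /kdelta rE eqxx; have -> : (2 * n == 2 * n - 1)%N = false by index_lia.
  have h (t : crystal R n) : Mcol1 t (2 * n) = level t.
    by rewrite -[(2 * n)%N]subn0 Mcol1_high ?big_geq ?divr1.
  rewrite !h lv M2 /w aE bE !mulr0n !mulr1n; field.
  by rewrite ?x0 ?b0 ?x1 ?b1 ?c0 ?nz1 ?z0.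
case: (eqVneq r (2 * n - 1)%N) => [rE|r2].
  have h (t : crystal R n) : Mcol1 t (2 * n - 1) = level t / xb t 1.
    by rewrite Mcol1_high ?big_nat1 //; index_lia.
  have ne : (2 * n - 1 == 2 * n)%N = false by index_lia.
  rewrite /s /kdelta rE eqxx ne !h lv M1 /w aE bE qb gE !mulr0n !mulr1n; field.
  by rewrite ?x0 ?b0 ?x1 ?b1 ?c0 ?nz1 ?nz2 ?z0.
have sE : s = Mcol1 p r by rewrite /s (negPf r1) (negPf r2) /=; ring.
have -> : s + b * ((1 + xb p 2 / xc p 2) * (xb p 1 * (z * s - w * kdelta r (2 * n))
      - w * kdelta r (2 * n - 1)) + w * kdelta r (2 * n - 1)) = c^-1 * s.
  rewrite /kdelta (negPf r1) (negPf r2) /= bE; field.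
  by rewrite c0 x1 b0 z0 addrC nz1.
rewrite sE.
case: (eqVneq r 1%N) => [->|r3].
  rewrite !M1 qx qb gE; field; by rewrite ?b0 ?c0 ?nz1 ?nz2.
case: (eqVneq r 2%N) => [->|r4].
  rewrite !M2 qx qx1 qb1 gE; field; by rewrite ?b1 ?c0 ?nz1 ?nz2.
case: (leqP r (n - 1)) => r5.
  by rewrite !Mcol1_low ?PX ?qx' ?qb' ?mulrA //; index_lia.
case: (eqVneq r n) => [->|r6].
  by rewrite !Mcol1_n PX //; index_lia.
case: (eqVneq r (n + 1)%N) => [->|r7].
  by rewrite !Mcol1_n1 PX //; index_lia.
have -> : r = (2 * n - (2 * n - r))%N by index_lia.
rewrite !Mcol1_high ?lv ?PB; try index_lia; field.
rewrite c0 P0 //; index_lia.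
Qed.

(** Prefix products are preserved unless they end between the two coordinates
    that are moved, so at most the rows i+1, i+2 and 2n-i-1 change.  In row i+2
    the changes of the product and of the last factor cancel; the other two
    account for the row operation. *)
Lemma first_column_mid i p a c r :
  (i < n - 2)%N -> Mmat_defined p -> c != 0 ->
  xc p i.+2 + xb p i.+2 != 0 -> xc p i.+2 + c * xb p i.+2 != 0 ->
  let q := e_act i.+1 c p in
  a = (c - 1) / (xb p i.+1 * (xc p i.+2 / xb p i.+2 + 1)) ->
  (1 <= r <= 2 * n)%N ->
  level q = level p /\
  Mcol1 q r = Mcol1 p r + a * ((r == i.+1)%N%:R * Mcol1 p i.+2
                               + (r == 2 * n - i.+1)%N%:R * Mcol1 p (2 * n - i)).
Proof.
move=> hi hp c0 nz1 nz2 q aE hr; have [hx hb _] := hp.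
have [] := e_act_mid c p hi; rewrite -/q; set g := xi c p i.+2.
have gE : g = (xc p i.+2 + c * xb p i.+2) / (xc p i.+2 + xb p i.+2) by [].
clearbody g q => -[qx qb] [qx1 qb1] qx' qb'.
have x0 : xc p i.+1 != 0 by apply: hx; index_lia.
have b0 : xb p i.+1 != 0 by apply: hb; index_lia.
have x1 : xc p i.+2 != 0 by apply: hx; index_lia.
have b1 : xb p i.+2 != 0 by apply: hb; index_lia.
have PX m : (m <= n.+1)%N -> m != i.+2 -> \prod_(1 <= k < m) xc q k = \prod_(1 <= k < m) xc p k.
  move=> hm hm2; case: (leqP m i.+1) => hm1.
    by apply: eq_big_nat => k hk; apply: qx'; index_lia.
  rewrite -[RHS]mul1r; apply: (prod_pair (i := i.+1)); try index_lia.
    rewrite qx qx1 gE; field; by rewrite ?c0 ?nz1 ?nz2.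
  by move=> k hk h1 h2; apply: qx'; index_lia.
have PB m : (m <= n)%N -> m != i.+2 -> \prod_(1 <= k < m) xb q k = \prod_(1 <= k < m) xb p k.
  move=> hm hm2; case: (leqP m i.+1) => hm1.
    by apply: eq_big_nat => k hk; apply: qb'; index_lia.
  rewrite -[RHS]mul1r; apply: (prod_pair (i := i.+1)); try index_lia.
    rewrite qb qb1 gE; field; by rewrite ?nz1 ?nz2.
  by move=> k hk h1 h2; apply: qb'; index_lia.
have lv : level q = level p by rewrite /level PX ?PB //; index_lia.
split=> //.
have P0 m : (m <= n)%N -> \prod_(1 <= k < m) xb p k != 0.
  by move=> hm; apply: prod_nat_neq0 => k hk; apply: hb; index_lia.
have PXS (t : crystal R n) : \prod_(1 <= k < i.+2) xc t k =
    \prod_(1 <= k < i.+1) xc t k * xc t i.+1.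
  by rewrite prod_recr.
have PBS (t : crystal R n) : \prod_(1 <= k < i.+2) xb t k =
    \prod_(1 <= k < i.+1) xb t k * xb t i.+1.
  by rewrite prod_recr.
case: (eqVneq r i.+1) => [->|r1].
  have -> : (i.+1 == 2 * n - i.+1)%N = false by index_lia.
  rewrite mulr0n mul0r addr0 mulr1n mul1r (Mcol1_low p (r := i.+2)) ?PXS; last by index_lia.
  case: (posnP i) => [i0|i0].
    move: x0 x1 b0 b1 nz1 nz2 qx qb aE gE; rewrite i0 => x0 x1 b0 b1 nz1 nz2 qx qb aE gE.
    rewrite /Mcol1 /= big_geq // qx qb gE aE; field.
    by rewrite ?x0 ?b0 ?x1 ?b1 ?c0 ?nz1 ?nz2.
  rewrite !Mcol1_low ?PX; try index_lia.
  rewrite qx qb gE aE; field.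
  by rewrite ?x0 ?b0 ?x1 ?b1 ?c0 ?nz1 ?nz2.
rewrite mulr0n mul0r add0r.
case: (eqVneq r (2 * n - i.+1)%N) => [->|r2].
  rewrite !Mcol1_high ?lv ?PBS ?PB; try index_lia.
  rewrite mulr1n mul1r qb gE aE; field.
  by rewrite ?x0 ?b0 ?x1 ?b1 ?c0 ?nz1 ?nz2 P0 //; index_lia.
rewrite mulr0n mul0r mulr0 addr0.
case: (eqVneq r i.+2) => [->|r3].
  rewrite !Mcol1_low ?PXS ?PX; try index_lia.
  rewrite qx qx1 qb1 gE; field.
  by rewrite ?x0 ?b0 ?x1 ?b1 ?c0 ?nz1 ?nz2.
case: (eqVneq r 1%N) => [r4|r4].
  by rewrite r4 /Mcol1 /= qx' ?qb' //; index_lia.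
case: (leqP r (n - 1)) => r5.
  by rewrite !Mcol1_low ?PX ?qx' ?qb' //; index_lia.
case: (eqVneq r n) => [->|r6].
  by rewrite !Mcol1_n PX //; index_lia.
case: (eqVneq r (n + 1)%N) => [->|r7].
  by rewrite !Mcol1_n1 PX //; index_lia.
have -> : r = (2 * n - (2 * n - r))%N by index_lia.
by rewrite !Mcol1_high ?lv ?PB //; index_lia.
Qed.

Lemma first_column_penult p a c r :
  Mmat_defined p -> c != 0 ->
  let q := e_act (n - 1) c p in
  a = (c - 1) / (xc p n * xb p (n - 1)) ->
  (1 <= r <= 2 * n)%N ->
  level q = level p /\
  Mcol1 q r = Mcol1 p r + a * ((r == n - 1)%N%:R * Mcol1 p n
                               + (r == n + 1)%N%:R * Mcol1 p (n + 2)).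
Proof.
move=> hp c0 q aE hr; have [hx hb _] := hp.
have [] := e_act_penult c p; rewrite -/q; clearbody q => qx qxn qx' qb.
have x0 : xc p (n - 1) != 0 by apply: hx; index_lia.
have x1 : xc p n != 0 by apply: hx; index_lia.
have b0 : xb p (n - 1) != 0 by apply: hb; index_lia.
have n2 : (n - 2).+1 = (n - 1)%N by index_lia.
have PX m : (m <= n - 1)%N -> \prod_(1 <= k < m) xc q k = \prod_(1 <= k < m) xc p k.
  by move=> hm; apply: eq_big_nat => k hk; apply: qx'; index_lia.
have PXS (t : crystal R n) : \prod_(1 <= k < n) xc t k =
    \prod_(1 <= k < n - 1) xc t k * xc t (n - 1).
  by apply: prod_recr_pred; index_lia.
have PXn (t : crystal R n) : \prod_(1 <= k < n.+1) xc t k =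
    \prod_(1 <= k < n - 1) xc t k * xc t (n - 1) * xc t n.
  by rewrite prod_recr ?PXS //; index_lia.
have PB m : (m <= n)%N -> \prod_(1 <= k < m) xb q k = \prod_(1 <= k < m) xb p k.
  by move=> hm; apply: eq_big_nat => k hk; apply: qb; index_lia.
have lv : level q = level p.
  by rewrite /level !PXn PX ?PB ?qx ?qxn //; field.
split=> //.
have P0 m : (m <= n)%N -> \prod_(1 <= k < m) xb p k != 0.
  by move=> hm; apply: prod_nat_neq0 => k hk; apply: hb; index_lia.
have Mn2 : Mcol1 p (n + 2) = \prod_(1 <= k < n - 1) xc p k * xc p (n - 1) * xc p n * xb p (n - 1).
  have -> : (n + 2 = 2 * n - (n - 2))%N by index_lia.
  rewrite Mcol1_high // n2 /level PXn.
  have -> : \prod_(1 <= k < n) xb p k = \prod_(1 <= k < n - 1) xb p k * xb p (n - 1).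
    by apply: prod_recr_pred; index_lia.
  field; apply: P0; index_lia.
case: (eqVneq r (n - 1)%N) => [->|r1].
  have -> : (n - 1 == n + 1)%N = false by index_lia.
  rewrite mulr0n mul0r addr0 mulr1n mul1r Mcol1_n !Mcol1_low ?PX ?PXn ?qx ?qb
      ?aE; try index_lia; field.
  by rewrite ?x1 ?b0.
rewrite mulr0n mul0r add0r.
case: (eqVneq r (n + 1)%N) => [->|r2].
  rewrite mulr1n mul1r Mn2 !Mcol1_n1 !PXS PX // qx aE; field.
  by rewrite ?x1 ?b0.
rewrite mulr0n mul0r mulr0 addr0.
case: (eqVneq r 1%N) => [r4|r4].
  by rewrite r4 /Mcol1 /= qx' ?qb //; index_lia.
case: (leqP r (n - 1)) => r5.
  by rewrite !Mcol1_low ?PX ?qx' ?qb //; index_lia.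
case: (eqVneq r n) => [->|r6].
  by rewrite !Mcol1_n !PXn PX // qx qxn; field.
have -> : r = (2 * n - (2 * n - r))%N by index_lia.
by rewrite !Mcol1_high ?lv ?PB //; index_lia.
Qed.

Lemma first_column_final p a c r :
  Mmat_defined p -> c != 0 ->
  let q := e_act n c p in
  a = (c - 1) / xb p (n - 1) ->
  (1 <= r <= 2 * n)%N ->
  level q = level p /\
  Mcol1 q r = Mcol1 p r + a * ((r == n - 1)%N%:R * Mcol1 p (n + 1)
                               + (r == n)%N%:R * Mcol1 p (n + 2)).
Proof.
move=> hp c0 q aE hr; have [hx hb _] := hp.
have [] := e_act_final c p; rewrite -/q; clearbody q => qxn qbn qx qb.
have x0 : xc p (n - 1) != 0 by apply: hx; index_lia.
have b0 : xb p (n - 1) != 0 by apply: hb; index_lia.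
have n2 : (n - 2).+1 = (n - 1)%N by index_lia.
have PX m : (m <= n)%N -> \prod_(1 <= k < m) xc q k = \prod_(1 <= k < m) xc p k.
  by move=> hm; apply: eq_big_nat => k hk; apply: qx; index_lia.
have PXS (t : crystal R n) : \prod_(1 <= k < n) xc t k =
    \prod_(1 <= k < n - 1) xc t k * xc t (n - 1).
  by apply: prod_recr_pred; index_lia.
have PXn (t : crystal R n) : \prod_(1 <= k < n.+1) xc t k = \prod_(1 <= k < n) xc t k * xc t n.
  by rewrite prod_recr //; index_lia.
have PBn (t : crystal R n) : \prod_(1 <= k < n) xb t k =
    \prod_(1 <= k < n - 1) xb t k * xb t (n - 1).
  by apply: prod_recr_pred; index_lia.
have PB m : (m <= n - 1)%N -> \prod_(1 <= k < m) xb q k = \prod_(1 <= k < m) xb p k.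
  by move=> hm; apply: eq_big_nat => k hk; apply: qb; index_lia.
have lv : level q = level p.
  by rewrite /level !PXn !PBn PX ?PB ?qxn ?qbn //; field.
split=> //.
have P0 m : (m <= n)%N -> \prod_(1 <= k < m) xb p k != 0.
  by move=> hm; apply: prod_nat_neq0 => k hk; apply: hb; index_lia.
have Mn2 : Mcol1 p (n + 2) = \prod_(1 <= k < n) xc p k * xc p n * xb p (n - 1).
  have -> : (n + 2 = 2 * n - (n - 2))%N by index_lia.
  rewrite Mcol1_high // n2 /level PXn PBn.
  field; apply: P0; index_lia.
case: (eqVneq r (n - 1)%N) => [->|r1].
  have -> : (n - 1 == n)%N = false by index_lia.
  rewrite mulr0n mul0r addr0 mulr1n mul1r Mcol1_n1 !Mcol1_low ?PX ?PXS ?qx ?qbn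
      ?aE; try index_lia; field.
  by rewrite ?c0 ?b0.
rewrite mulr0n mul0r add0r.
case: (eqVneq r n) => [->|r2].
  rewrite mulr1n mul1r Mn2 !Mcol1_n !PXn PX // qxn aE; field.
  exact: b0.
rewrite mulr0n mul0r mulr0 addr0.
case: (eqVneq r 1%N) => [r4|r4].
  by rewrite r4 /Mcol1 /= qx ?qb //; index_lia.
case: (leqP r (n - 1)) => r5.
  by rewrite !Mcol1_low ?PX ?qx ?qb //; index_lia.
case: (eqVneq r (n + 1)%N) => [->|r6].
  by rewrite !Mcol1_n1 PX.
have -> : r = (2 * n - (2 * n - r))%N by index_lia.
by rewrite !Mcol1_high ?lv ?PB //; index_lia.
Qed.

(** * Comparison of the two runs *)

(** The crystal index is i+1.  Both runs agree up to step i and again from step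
    i+2 on.  At step i+1 the low states differ by the column operation on column
    i+2, while the downward run acquires the factor 1/xi, which the change of
    Xbar_(i+2) compensates; the other half of the column operation, on column
    2n-i, comes from the change of Xbar_(i+1) and of the source at 2n-i. *)
Lemma row_entry_mid i p z w s a b c d e j :
  (i < n - 2)%N ->
  Mmat_defined p -> c != 0 -> xc p i.+2 + xb p i.+2 != 0 -> xc p i.+2 + c * xb p i.+2 != 0 ->
  let q := e_act i.+1 c p in
  a = (c - 1) / (xb p i.+1 * (xc p i.+2 / xb p i.+2 + 1)) ->
  b = (c^-1 - 1) / (xc p i.+1 * (xb p i.+2 / xc p i.+2 + 1)) ->
  (forall k, e k =
      d k + a * ((k == i.+2)%:R * d i.+1 + (k == 2 * n - i)%N%:R * d (2 * n - i.+1)%N)) ->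
  (1 <= j <= 2 * n)%N ->
  row_entry q z w s d j = row_entry p z w s e j
    + b * ((j == i.+2)%:R * row_entry p z w s e i.+1
           + (j == 2 * n - i)%N%:R * row_entry p z w s e (2 * n - i.+1)).
Proof.
move=> hi [hx hb _] c0 nz1 nz2 q aE bE eE hj.
have [] := e_act_mid c p hi; rewrite -/q; set g := xi c p i.+2 => -[qx qb] [qx1 qb1] qx' qb'.
have x0 : xc p i.+1 != 0 by apply: hx; index_lia.
have b0 : xb p i.+1 != 0 by apply: hb; index_lia.
have x1 : xc p i.+2 != 0 by apply: hx; index_lia.
have b1 : xb p i.+2 != 0 by apply: hb; index_lia.
have ne1 : (i.+2 == 2 * n - i)%N = false by index_lia.
have e_same k : k != i.+2 -> k != (2 * n - i)%N -> e k = d k.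
  by move=> /negPf h1 /negPf h2; rewrite eE h1 h2 /=; ring.
have e1 : e i.+2 = d i.+2 + a * d i.+1.
  by rewrite eE eqxx ne1 /=; ring.
have e2 : e (2 * n - i)%N = d (2 * n - i)%N + a * d (2 * n - i.+1)%N.
  by rewrite eE eqxx eq_sym ne1 /=; ring.
have gE : g = (xc p i.+2 + c * xb p i.+2) / (xc p i.+2 + xb p i.+2) by [].
clearbody g q.
have L1 k : (k <= i)%N -> low_state q w s d k = low_state p w s e k.
  move=> hk; apply: (@low_state_eq _ _ _ _ _ _ _ _ _ 0) => // [|m hm].
    by rewrite /= e_same //; index_lia.
  by rewrite qx' ?qb' ?e_same //; index_lia.
have L2 : low_state q w s d i.+1 =
    low_state p w s e i.+1 + b * (low_state p w s e i + w * d i.+1) + w * a * d i.+1.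
  rewrite /= (e_same i.+1) ?L1 ?qx ?qb ?aE ?bE; try index_lia.
  rewrite gE; field.
  by rewrite ?x0 ?b0 ?x1 ?b1 ?c0 ?nz1 ?nz2.
have L3 k : (i.+1 < k <= n - 1)%N -> low_state q w s d k = low_state p w s e k.
  move=> hk; apply: (@low_state_eq _ _ _ _ _ _ _ _ _ i.+2) => [||m hm]; first by index_lia.
    rewrite /= in L2 *.
    rewrite L2 e1 qx1 qb1 aE bE (e_same i.+1); try index_lia.
    rewrite gE; field.
    by rewrite ?x0 ?b0 ?x1 ?b1 ?c0 ?nz1 ?nz2.
  by rewrite qx' ?qb' ?e_same //; index_lia.
have H1 k : (k <= i)%N -> high_state q z w s d k = high_state p z w s e k.
  move=> hk; apply: (@high_state_eq _ _ _ _ _ _ _ _ _ _ 0) => // m hm.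
  by rewrite qb' ?e_same //; index_lia.
have H2 : high_state q z w s d i.+1 - w * d (2 * n - i.+1)%N =
    g^-1 * (high_state p z w s e i.+1 - w * d (2 * n - i.+1)%N).
  rewrite !high_stateS e2 H1 ?qb ?aE; try index_lia.
  rewrite gE; field.
  by rewrite ?x0 ?b0 ?x1 ?b1 ?c0 ?nz1 ?nz2.
have H3 k : (i.+1 < k <= n - 2)%N -> high_state q z w s d k = high_state p z w s e k.
  move=> hk; apply: (@high_state_eq _ _ _ _ _ _ _ _ _ _ i.+2) => [||m hm]; first by index_lia.
    rewrite 2!(high_stateS _ _ _ _ _ i.+1) H2 e_same ?qb1; try index_lia.
    rewrite gE; field.
    by rewrite ?x0 ?b0 ?x1 ?b1 ?c0 ?nz1 ?nz2.
  by rewrite qb' ?e_same //; index_lia.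
case: (leqP j (n - 1)) => hj1.
  have -> : (j == 2 * n - i)%N = false by index_lia.
  rewrite mulr0n mul0r addr0 !row_entry_low; try index_lia.
  case: (eqVneq j i.+2) => [->|ji] /=.
    rewrite /= in L2 *; rewrite L2 e1 e_same; [ring|index_lia|index_lia].
  have -> : low_state q w s d j.-1 = low_state p w s e j.-1.
    by case: (ltnP j i.+2) => ?; [apply: L1 | apply: L3]; index_lia.
  by rewrite e_same ?mul0r; [ring|index_lia|index_lia].
have -> : (j == i.+2)%N = false by index_lia.
rewrite mulr0n mul0r add0r.
case: (eqVneq j n) => [->|hj2].
  have -> : (n == 2 * n - i)%N = false by index_lia.
  rewrite mulr0n mul0r mulr0 addr0 !row_entry_n ?L3 ?e_same; try index_lia; ring.
case: (eqVneq j (n + 1)%N) => [->|hj3].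
  have -> : (n + 1 == 2 * n - i)%N = false by index_lia.
  rewrite mulr0n mul0r mulr0 addr0 !row_entry_n1 ?L3 ?(e_same n) ?qx'; try index_lia; ring.
rewrite (row_entry_high _ _ _ _ _ (j := i.+1)); last by index_lia.
case: (eqVneq j (2 * n)%N) => [->|hj4].
  rewrite !row_entry_last ?(e_same 1%N); try index_lia.
  case: (posnP i) => [i0|i1].
    move: i0 => ?; subst i.
    have -> : (2 * n == 2 * n - 0)%N = true by index_lia.
    rewrite mulr1n mul1r high_stateS qx qb /Xbar.
    rewrite (e_same (2 * n - 1)%N); try index_lia.
    rewrite subn0 in e2 *; rewrite e2 /= aE bE gE; field.
    by rewrite ?x0 ?b0 ?x1 ?b1 ?c0 ?nz1 ?nz2.
  have -> : (2 * n == 2 * n - i)%N = false by index_lia.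
  rewrite mulr0n mul0r mulr0 addr0 H1 ?qx' ?qb' ?e_same; try index_lia; ring.
have [k -> hk] : exists2 k, j = (2 * n - k)%N & (1 <= k <= n - 2)%N.
  exists (2 * n - j)%N; index_lia.
rewrite !row_entry_high /Xbar; try index_lia.
case: (eqVneq k i) => [->|hki].
  rewrite eqxx mulr1n mul1r e2 H1 ?qx ?qb; try index_lia.
  rewrite (e_same (2 * n - i.+1)%N); try index_lia.
  rewrite high_stateS e2 aE bE gE; field.
  by rewrite ?x0 ?b0 ?x1 ?b1 ?c0 ?nz1 ?nz2.
have -> : (2 * n - k == 2 * n - i)%N = false by index_lia.
rewrite mulr0n mul0r mulr0 addr0.
case: (eqVneq k i.+1) => [->|hki1].
  rewrite H2 qx1 qb1 e_same; try index_lia.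
  rewrite gE; field.
  by rewrite ?x0 ?b0 ?x1 ?b1 ?c0 ?nz1 ?nz2.
have -> : high_state q z w s d k = high_state p z w s e k.
  by case: (ltnP k i.+1) => ?; [apply: H1 | apply: H3]; index_lia.
by rewrite qx' ?qb' ?e_same //; index_lia.
Qed.

(** Column n+2 receives a multiple of column n+1, the last column of the upward
    run.  The difference that occurs is expressed by the downward run, and the
    relation assumed here, which is [hinge] after the row operation, converts
    it. *)
Lemma row_entry_penult p z w s a b c d e j :
  Mmat_defined p -> c != 0 ->
  let q := e_act (n - 1) c p in
  a = (c - 1) / (xc p n * xb p (n - 1)) -> b = (c^-1 - 1) / xc p (n - 1) ->
  (forall k, e k = d k + a * ((k == n)%:R * d (n - 1)%N + (k == n + 2)%N%:R * d (n + 1)%N)) ->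
  xc p n * high_state p z w s e (n - 1) =
      low_state p w s e (n - 1) + w * e (n + 1)%N + xc p n * (w * e n) ->
  (1 <= j <= 2 * n)%N ->
  row_entry q z w s d j = row_entry p z w s e j
    + b * ((j == n)%:R * row_entry p z w s e (n - 1)
           + (j == n + 2)%N%:R * row_entry p z w s e (n + 1)).
Proof.
have [qx qxn qx' qb] := e_act_penult c p.
move=> [hx hb _] c0 q; rewrite -/q in qx qxn qx' qb; clearbody q => aE bE eE hinge hj.
have x0 : xc p (n - 1) != 0 by apply: hx; index_lia.
have x1 : xc p n != 0 by apply: hx; index_lia.
have b0 : xb p (n - 1) != 0 by apply: hb; index_lia.
have ne1 : (n == n + 2)%N = false by index_lia.
have e_same k : k != n -> k != (n + 2)%N -> e k = d k.
  by move=> /negPf h1 /negPf h2; rewrite eE h1 h2 /=; ring.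
have en : e n = d n + a * d (n - 1)%N.
  by rewrite eE eqxx ne1 /=; ring.
have en2 : e (n + 2)%N = d (n + 2)%N + a * d (n + 1)%N.
  by rewrite eE eqxx eq_sym ne1 /=; ring.
have L k : (k <= n - 2)%N -> low_state q w s d k = low_state p w s e k.
  move=> hk; apply: (@low_state_eq _ _ _ _ _ _ _ _ _ 0) => // [|m hm].
    by rewrite /= e_same //; index_lia.
  by rewrite qx' ?qb ?e_same //; index_lia.
have H k : (k <= n - 2)%N -> high_state q z w s d k = high_state p z w s e k.
  move=> hk; apply: (@high_state_eq _ _ _ _ _ _ _ _ _ _ 0) => // m hm.
  by rewrite qb ?e_same //; index_lia.
have n2 : (n - 1).-1 = (n - 2)%N by index_lia.
have n1 : (n - 2).+1 = (n - 1)%N by index_lia.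
have LE : low_state q w s d (n - 1) =
    low_state p w s e (n - 1) + b * (low_state p w s e (n - 2) + w * d (n - 1)%N).
  rewrite (low_stateE q) ?n2 ?(low_stateE p _ _ _ (j := n - 1)) ?n2 ?L ?qx ?qb
      ?(e_same (n - 1)%N) ?bE; try index_lia; field.
  by rewrite x0 b0 c0.
case: (leqP j (n - 1)) => hj1.
  have -> : (j == n)%N = false by index_lia.
  have -> : (j == n + 2)%N = false by index_lia.
  rewrite !mulr0n !mul0r addr0 mulr0 addr0 !row_entry_low ?L ?e_same //; index_lia.
case: (eqVneq j n) => [->|hj2].
  rewrite ne1 mulr1n mul1r mulr0n mul0r addr0 !row_entry_n ?row_entry_low ?LE ?n2
      ?(e_same (n + 1)%N) ?(e_same (n - 1)%N); try index_lia.
  ring.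
rewrite mulr0n mul0r add0r.
case: (eqVneq j (n + 1)%N) => [->|hj3].
  have -> : (n + 1 == n + 2)%N = false by index_lia.
  rewrite mulr0n mul0r mulr0 addr0 !row_entry_n1 ?LE ?qxn ?en; try index_lia.
  rewrite low_stateE ?n2 ?(e_same (n - 1)%N) ?aE ?bE; try index_lia; field.
  by rewrite x0 x1 b0 c0.
case: (eqVneq j (2 * n)%N) => [->|hj4].
  have -> : (2 * n == n + 2)%N = false by index_lia.
  rewrite mulr0n mul0r mulr0 addr0 !row_entry_last ?H ?qb ?qx' ?e_same; try index_lia; ring.
have [k -> hk] : exists2 k, j = (2 * n - k)%N & (1 <= k <= n - 2)%N.
  exists (2 * n - j)%N; index_lia.
case: (eqVneq k (n - 2)%N) => [->|hk2].
  have -> : (2 * n - (n - 2) == n + 2)%N = true by index_lia.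
  rewrite mulr1n mul1r row_entry_high ?row_entry_high ?row_entry_n1; try index_lia.
  have -> : (2 * n - (n - 2))%N = (n + 2)%N by index_lia.
  move: hinge; rewrite (high_stateE _ _ _ _ _ (j := n - 1)) ?n2; last by index_lia.
  have -> : (2 * n - (n - 2))%N = (n + 2)%N by index_lia.
  rewrite H // (e_same (n + 1)%N) ?en ?en2; try index_lia.
  (* Both runs are expressed by the last downward value [v], after which the *)
  (* claim is an identity between independent quantities.                    *)
  set v := _ - w * (d (n + 2)%N + _) => hv.
  have -> : low_state p w s e (n - 1) =
      xc p n * (xb p (n - 1) * v) - w * d (n + 1)%N - xc p n * (w * (d n + a * d (n - 1)%N)).
    by rewrite hv; ring.
  have -> : high_state p z w s e (n - 2) =
      v + w * (d (n + 2)%N + a * d (n + 1)%N) by rewrite /v; ring.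
  rewrite /Xbar n1 qx qb ?aE ?bE; try index_lia; field.
  by rewrite x0 x1 b0 c0.
have -> : (2 * n - k == n + 2)%N = false by index_lia.
by rewrite mulr0n mul0r mulr0 addr0 !row_entry_high /Xbar ?H ?qx' ?qb ?e_same //; index_lia.
Qed.

(** As for [row_entry_penult], with the roles of the columns n and n+1
    exchanged. *)
Lemma row_entry_final p z w s a b c d e j :
  Mmat_defined p -> c != 0 ->
  let q := e_act n c p in
  a = (c - 1) / xb p (n - 1) -> b = (c^-1 - 1) / (xc p (n - 1) * xc p n) ->
  (forall k, e k = d k + a * ((k == n + 1)%N%:R * d (n - 1)%N + (k == n + 2)%N%:R * d n)) ->
  xc p n * high_state p z w s e (n - 1) =
      low_state p w s e (n - 1) + w * e (n + 1)%N + xc p n * (w * e n) ->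
  (1 <= j <= 2 * n)%N ->
  row_entry q z w s d j = row_entry p z w s e j
    + b * ((j == n + 1)%N%:R * row_entry p z w s e (n - 1)
           + (j == n + 2)%N%:R * row_entry p z w s e n).
Proof.
have [qxn qbn qx qb] := e_act_final c p.
move=> [hx hb _] c0 q; rewrite -/q in qxn qbn qx qb; clearbody q => aE bE eE hinge hj.
have x0 : xc p (n - 1) != 0 by apply: hx; index_lia.
have x1 : xc p n != 0 by apply: hx; index_lia.
have b0 : xb p (n - 1) != 0 by apply: hb; index_lia.
have ne1 : (n + 1 == n + 2)%N = false by index_lia.
have e_same k : k != (n + 1)%N -> k != (n + 2)%N -> e k = d k.
  by move=> /negPf h1 /negPf h2; rewrite eE h1 h2 /=; ring.
have en1 : e (n + 1)%N = d (n + 1)%N + a * d (n - 1)%N.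
  by rewrite eE eqxx ne1 /=; ring.
have en2 : e (n + 2)%N = d (n + 2)%N + a * d n.
  by rewrite eE eqxx eq_sym ne1 /=; ring.
have L k : (k <= n - 2)%N -> low_state q w s d k = low_state p w s e k.
  move=> hk; apply: (@low_state_eq _ _ _ _ _ _ _ _ _ 0) => // [|m hm].
    by rewrite /= e_same //; index_lia.
  by rewrite qx ?qb ?e_same //; index_lia.
have H k : (k <= n - 2)%N -> high_state q z w s d k = high_state p z w s e k.
  move=> hk; apply: (@high_state_eq _ _ _ _ _ _ _ _ _ _ 0) => // m hm.
  by rewrite qb ?e_same //; index_lia.
have n2 : (n - 1).-1 = (n - 2)%N by index_lia.
have n1 : (n - 2).+1 = (n - 1)%N by index_lia.
have LE : low_state q w s d (n - 1) = low_state p w s e (n - 1) + w * a * d (n - 1)%N.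
  rewrite (low_stateE q) ?n2 ?(low_stateE p _ _ _ (j := n - 1)) ?n2 ?L ?qx ?qbn
      ?(e_same (n - 1)%N) ?aE; try index_lia; field.
  by rewrite x0 b0 c0.
case: (leqP j (n - 1)) => hj1.
  have -> : (j == n + 1)%N = false by index_lia.
  have -> : (j == n + 2)%N = false by index_lia.
  rewrite !mulr0n !mul0r addr0 mulr0 addr0 !row_entry_low ?L ?e_same //; index_lia.
case: (eqVneq j n) => [->|hj2].
  have -> : (n == n + 1)%N = false by index_lia.
  have -> : (n == n + 2)%N = false by index_lia.
  rewrite !mulr0n !mul0r addr0 mulr0 addr0 !row_entry_n ?LE ?en1; try index_lia.
  ring.
case: (eqVneq j (n + 1)%N) => [->|hj3].
  rewrite ne1 mulr1n mul1r mulr0n mul0r addr0 !row_entry_n1 ?row_entry_low ?LE ?n2 ?qxn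
      ?e_same; try index_lia.
  rewrite low_stateE ?n2 ?(e_same (n - 1)%N) ?aE ?bE; try index_lia; field.
  by rewrite x0 x1 b0 c0.
rewrite mulr0n mul0r add0r.
case: (eqVneq j (2 * n)%N) => [->|hj4].
  have -> : (2 * n == n + 2)%N = false by index_lia.
  rewrite mulr0n mul0r mulr0 addr0 !row_entry_last ?H ?qb ?qx ?e_same; try index_lia; ring.
have [k -> hk] : exists2 k, j = (2 * n - k)%N & (1 <= k <= n - 2)%N.
  exists (2 * n - j)%N; index_lia.
case: (eqVneq k (n - 2)%N) => [->|hk2].
  have -> : (2 * n - (n - 2) == n + 2)%N = true by index_lia.
  rewrite mulr1n mul1r row_entry_high ?row_entry_high ?row_entry_n; try index_lia.
  have -> : (2 * n - (n - 2))%N = (n + 2)%N by index_lia.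
  move: hinge; rewrite (high_stateE _ _ _ _ _ (j := n - 1)) ?n2; last by index_lia.
  have -> : (2 * n - (n - 2))%N = (n + 2)%N by index_lia.
  rewrite H // (e_same n) ?en1 ?en2; try index_lia.
  (* Both runs are expressed by the last downward value [v], after which the *)
  (* claim is an identity between independent quantities.                    *)
  set v := _ - w * (d (n + 2)%N + _) => hv.
  have -> : low_state p w s e (n - 1) =
      xc p n * (xb p (n - 1) * v) - w * (d (n + 1)%N + a * d (n - 1)%N) - xc p n * (w * d n).
    by rewrite hv; ring.
  have -> : high_state p z w s e (n - 2) = v + w * (d (n + 2)%N + a * d n) by rewrite /v; ring.
  rewrite /Xbar n1 qx ?qbn ?aE ?bE; try index_lia; field.
  by rewrite x0 x1 b0 c0.
have -> : (2 * n - k == n + 2)%N = false by index_lia.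
by rewrite mulr0n mul0r mulr0 addr0 !row_entry_high /Xbar ?H ?qx ?qb ?e_same //; index_lia.
Qed.

(** The runs are disturbed at their common start: the first entry itself moves
    from [s] to [t], and each run is restored after two steps. *)
Lemma row_entry_affine p z w s t a b c d e j :
  Mmat_defined p -> c != 0 -> z != 0 ->
  xc p 2 + xb p 2 != 0 -> xc p 2 + c * xb p 2 != 0 ->
  let q := e_act 0 c p in
  a = (c - 1) / (z * (xc p 1 * (xc p 2 / xb p 2 + 1))) ->
  b = (c^-1 - 1) / (z * (xb p 1 * (xb p 2 / xc p 2 + 1))) ->
  (forall k, e k = d k + a * ((k == 1)%N%:R * d (2 * n - 1)%N + (k == 2)%N%:R * d (2 * n)%N)) ->
  t = s + b * row_entry p z w s e (2 * n - 1) ->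
  (1 <= j <= 2 * n)%N ->
  row_entry q z w t d j = row_entry p z w s e j
    + b * ((j == 1)%N%:R * row_entry p z w s e (2 * n - 1)
           + (j == 2)%N%:R * row_entry p z w s e (2 * n)).
Proof.
have [] := e_act_affine c p.
set g := xi c p 2; set q := e_act 0 c p => -[qx qb] [qx1 qb1] qx' qb'.
move=> [hx hb _] c0 z0 nz1 nz2; rewrite -/q; clearbody q => q' aE bE eE tE hj.
have x0 : xc p 1 != 0 by apply: hx; index_lia.
have b0 : xb p 1 != 0 by apply: hb; index_lia.
have x1 : xc p 2 != 0 by apply: hx; index_lia.
have b1 : xb p 2 != 0 by apply: hb; index_lia.
have e_same k : (2 < k)%N -> e k = d k.
  move=> hk; rewrite eE; have -> : (k == 1)%N = false by index_lia.
  by have -> : (k == 2)%N = false by [index_lia]; rewrite /=; ring.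
have e1 : e 1%N = d 1%N + a * d (2 * n - 1)%N by rewrite eE /=; ring.
have e2 : e 2%N = d 2%N + a * d (2 * n)%N by rewrite eE /=; ring.
have gE : g = (xc p 2 + c * xb p 2) / (xc p 2 + xb p 2) by [].
clearbody g.
have Pn1 : row_entry p z w s e (2 * n - 1) = (1 + xb p 2 / xc p 2) *
    (xb p 1 * (z * s - w * d (2 * n)%N) - w * d (2 * n - 1)%N) + w * d (2 * n - 1)%N.
  by rewrite row_entry_high /= ?subn0 ?e_same //; index_lia.
have Pn : row_entry p z w s e (2 * n) = xb p 1 / xc p 1 * (z * s - w * d (2 * n)%N)
    + z * w * (d 1%N + a * d (2 * n - 1)%N).
  by rewrite row_entry_last /= ?e1 ?e_same //; index_lia.
have L1 : low_state q w t d 1 + w * d 2%N =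
    low_state p w s e 1 + w * e 2%N + b * row_entry p z w s e (2 * n).
  rewrite e2 Pn /= e1 tE qx qb Pn1 bE aE gE; field.
  by rewrite ?x0 ?b0 ?x1 ?b1 ?c0 ?nz1 ?nz2 ?z0.
have L2 k : (1 < k <= n - 1)%N -> low_state q w t d k = low_state p w s e k.
  move=> hk; apply: (@low_state_eq _ _ _ _ _ _ _ _ _ 2) => [||m hm]; first by index_lia.
    have -> : low_state q w t d 2 =
        (low_state q w t d 1 + w * d 2%N) / xc q 2 + w * d 2%N / xb q 2 by [].
    rewrite L1 Pn qx1 qb1 aE bE /= e1 e2 aE gE; field.
    by rewrite ?x0 ?b0 ?x1 ?b1 ?c0 ?nz1 ?nz2 ?z0.
  by rewrite qx' ?qb' ?e_same //; index_lia.
have H1 : high_state q z w t d 1 - w * d (2 * n - 1)%N =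
    g^-1 * (high_state p z w s e 1 - w * d (2 * n - 1)%N).
  rewrite /= subn0 (e_same (2 * n)%N); last by index_lia.
  rewrite tE Pn1 bE qb gE; field.
  by rewrite ?x0 ?b0 ?x1 ?b1 ?c0 ?nz1 ?nz2 ?z0.
have H2 k : (1 < k <= n - 2)%N -> high_state q z w t d k = high_state p z w s e k.
  move=> hk; apply: (@high_state_eq _ _ _ _ _ _ _ _ _ _ 2) => [||m hm]; first by index_lia.
    rewrite 2!(high_stateS _ _ _ _ _ 1) H1 (e_same (2 * n - 1)%N) ?qb1; last by index_lia.
    rewrite gE; field.
    by rewrite ?x0 ?b0 ?x1 ?b1 ?c0 ?nz1 ?nz2 ?z0.
  by rewrite qb' ?e_same //; index_lia.
case: (leqP j (n - 1)) => hj1.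
  rewrite (row_entry_low q) // [row_entry p z w s e j]row_entry_low //.
  case: j hj hj1 => [|[|[|j]]] // hj hj1.
  - by rewrite tE /=; ring.
  - by rewrite [LHS]L1 /=; ring.
  by rewrite mulr0n !mul0r addr0 mulr0 addr0 L2 ?e_same //; index_lia.
have -> : (j == 1)%N = false by index_lia.
have -> : (j == 2)%N = false by index_lia.
rewrite mulr0n !mul0r addr0 mulr0 addr0.
case: (eqVneq j n) => [->|hj2].
  by rewrite !row_entry_n ?L2 ?e_same //; index_lia.
case: (eqVneq j (n + 1)%N) => [->|hj3].
  by rewrite !row_entry_n1 ?L2 ?e_same ?qx' //; index_lia.
case: (eqVneq j (2 * n)%N) => [->|hj4].
  rewrite Pn row_entry_last; last by index_lia.
  rewrite /= qx qb tE Pn1 aE bE gE; field.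
  by rewrite ?x0 ?b0 ?x1 ?b1 ?c0 ?nz1 ?nz2 ?z0.
have [k -> hk] : exists2 k, j = (2 * n - k)%N & (1 <= k <= n - 2)%N.
  exists (2 * n - j)%N; index_lia.
rewrite !row_entry_high /Xbar; try index_lia.
case: (eqVneq k 1%N) => [->|hk1].
  rewrite H1 qx1 qb1 (e_same (2 * n - 1)%N); last by index_lia.
  rewrite gE; field.
  by rewrite ?x0 ?b0 ?x1 ?b1 ?c0 ?nz1 ?nz2 ?z0.
by rewrite H2 ?qx' ?qb' ?e_same //; index_lia.
Qed.

(** * Row and column operations *)

(** Left multiplication by [shear] below, on a single column. *)
Definition rowop (a1 b1 a2 b2 : nat) (t : R) (f : nat -> R) (r : nat) : R :=
  f r + t * ((r == a1)%:R * f b1 + (r == a2)%:R * f b2).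

Section RowOp.
Variables (a1 b1 a2 b2 : nat) (t : R).
Local Notation op := (rowop a1 b1 a2 b2 t).

Lemma low_rowop p w (s : nat -> R) (d : nat -> nat -> R) r j :
  low_state p w (op s r) (fun k => op (d^~ k) r) j = op (fun r' => low_state p w (s r') (d r') j) r.
Proof.
rewrite /rowop; elim: j => [|j IH] /=; first by ring.
by rewrite IH; ring.
Qed.

Lemma high_rowop p z w (s : nat -> R) (d : nat -> nat -> R) r j :
  high_state p z w (op s r) (fun k => op (d^~ k) r) j =
      op (fun r' => high_state p z w (s r') (d r') j) r.
Proof.
rewrite /rowop; elim: j => [|j IH] /=; first by ring.
by rewrite IH; ring.
Qed.

Lemma row_entry_rowop p z w (s : nat -> R) (d : nat -> nat -> R) r j :
  row_entry p z w (op s r) (fun k => op (d^~ k) r) j =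
      op (fun r' => row_entry p z w (s r') (d r') j) r.
Proof.
rewrite /row_entry low_rowop low_rowop !high_rowop /rowop.
by do 4![case: ifP => _; first by ring]; ring.
Qed.

(** [hinge] is linear in the row, so it passes to rows of G_i(a) M(x). *)
Lemma hinge_rowop p z r : Mmat_defined p -> (1 <= r <= 2 * n)%N ->
  (1 <= b1 <= 2 * n)%N -> (1 <= b2 <= 2 * n)%N ->
  let w := level p * z - 1 in
  let s := op (Mcol1 p) r in let e := fun k => op (@kdelta R ^~ k) r in
  xc p n * high_state p z w s e (n - 1)
  = low_state p w s e (n - 1) + w * e (n + 1)%N + xc p n * (w * e n).
Proof.
move=> hp hr h1 h2 w s e; rewrite low_rowop high_rowop /e /rowop.
have h r' : (1 <= r' <= 2 * n)%N -> low_state p w (Mcol1 p r') (kdelta r') (n - 1) =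
    xc p n * high_state p z w (Mcol1 p r') (kdelta r') (n - 1) - w * kdelta r' (n + 1)
     - xc p n * (w * kdelta r' n).
  by move=> hr'; rewrite hinge // -/w; ring.
by rewrite !h //; ring.
Qed.

Lemma rowop_kdelta r k : op (@kdelta R ^~ k) r =
  kdelta r k + t * ((k == b1)%:R * kdelta r a1 + (k == b2)%:R * kdelta r a2).
Proof. by rewrite /rowop /kdelta (eq_sym k b1) (eq_sym k b2); ring. Qed.
End RowOp.

Lemma Eunit_mul m (a b : nat) (f : nat -> nat -> R) : (1 <= b <= m)%N ->
  Eunit m a b *m (\matrix_(r < m, s < m) f r.+1 s.+1)
  = \matrix_(r, s) ((r.+1 == a)%:R * f b s.+1).
Proof.
move=> hb; have hb' : (b.-1 < m)%N by index_lia.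
have eb : b.-1.+1 = b by index_lia.
apply/matrixP => r s; rewrite !mxE (bigD1 (Ordinal hb')) //= !mxE /= eb eqxx andbT.
rewrite big1 ?addr0 // => k hk; rewrite !mxE.
have -> : (k.+1 == b) = false; last by rewrite andbF mul0r.
by apply: contraNF hk => /eqP hk; apply/eqP/val_inj; rewrite /= -hk.
Qed.

Lemma mul_Eunit m (a b : nat) (f : nat -> nat -> R) : (1 <= a <= m)%N ->
  (\matrix_(r < m, s < m) f r.+1 s.+1) *m Eunit m a b
  = \matrix_(r, s) ((s.+1 == b)%:R * f r.+1 a).
Proof.
move=> ha; have ha' : (a.-1 < m)%N by index_lia.
have ea : a.-1.+1 = a by index_lia.
apply/matrixP => r s; rewrite !mxE (bigD1 (Ordinal ha')) //= !mxE /= ea eqxx mulrC.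
rewrite big1 ?addr0 // => k hk; rewrite !mxE.
have -> : (k.+1 == a) = false; last by rewrite mulr0.
by apply: contraNF hk => /eqP hk; apply/eqP/val_inj; rewrite /= -hk.
Qed.

(** All the matrices G_i have this form, which allows the four kinds of indices
    to be treated at once. *)
Definition shear m (a1 b1 a2 b2 : nat) (t : R) : 'M[R]_m :=
  1%:M + t *: (Eunit m a1 b1 + Eunit m a2 b2).

Lemma shearD m (a1 b1 a2 b2 : nat) (t u : R) :
  b1 != a1 -> b1 != a2 -> b2 != a1 -> b2 != a2 ->
  shear m a1 b1 a2 b2 t *m shear m a1 b1 a2 b2 u = shear m a1 b1 a2 b2 (t + u).
Proof.
move=> h11 h12 h21 h22; rewrite /shear.
have E0 (a b a' b' : nat) : b != a' -> Eunit m a b *m Eunit m a' b' = 0 :> 'M[R]_m.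
  move=> hb; apply/matrixP => r s; rewrite !mxE big1 // => k _; rewrite !mxE.
  by case: (eqVneq k.+1 b) => [->|_]; rewrite ?(negPf hb) ?andbF ?mulr0 ?mul0r.
set N := Eunit m a1 b1 + Eunit m a2 b2.
have NN : N *m N = 0 by rewrite /N !mulmxDl !mulmxDr !E0 // !addr0.
by rewrite mulmxDl mul1mx mulmxDr mulmx1 -scalemxAl -scalemxAr NN !scaler0 addr0
  scalerDl addrAC addrA.
Qed.

(** The identity for one factor, reduced to the comparison of two runs in each
    row. *)
Lemma Mmat_shear p q z (t u : R) (a1 b1 a2 b2 : nat) :
  (1 <= a1 <= 2 * n)%N -> (1 <= b1 <= 2 * n)%N ->
  (1 <= a2 <= 2 * n)%N -> (1 <= b2 <= 2 * n)%N ->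
  Mmat_defined p -> Mmat_defined q -> level q = level p ->
  let w := level p * z - 1 in
  (forall r j, (1 <= r <= 2 * n)%N -> (1 <= j <= 2 * n)%N ->
   let s := rowop a1 b1 a2 b2 t (Mcol1 p) r in
   let e := fun k => rowop a1 b1 a2 b2 t (@kdelta R ^~ k) r in
   row_entry q z w (Mcol1 q r) (kdelta r) j =
   row_entry p z w s e j + u * ((j == b1)%:R * row_entry p z w s e a1
                           + (j == b2)%:R * row_entry p z w s e a2)) ->
  Mmat q z = shear (2 * n) a1 b1 a2 b2 t *m Mmat p z *m shear (2 * n) a1 b1 a2 b2 u.
Proof.
move=> ha1 hb1 ha2 hb2 hp hq lv w H.
set S := shear _ _ _ _ _ t.
have SM : S *m Mmat p z = \matrix_(r, j) rowop a1 b1 a2 b2 t (fun r' => Mentry p z r' j.+1) r.+1.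
  rewrite /S /shear mulmxDl mul1mx -scalemxAl mulmxDl !Eunit_mul //.
  by apply/matrixP => r j; rewrite !mxE.
rewrite SM /shear mulmxDr mulmx1 -scalemxAr mulmxDr.
rewrite (@mul_Eunit _ _ _ (fun r j => rowop a1 b1 a2 b2 t (fun r' => Mentry p z r' j) r)) //.
rewrite (@mul_Eunit _ _ _ (fun r j => rowop a1 b1 a2 b2 t (fun r' => Mentry p z r' j) r)) //.
apply/matrixP => r j; rewrite !mxE.
have hr : (1 <= r.+1 <= 2 * n)%N by rewrite /= ltn_ord.
have hj : (1 <= j.+1 <= 2 * n)%N by rewrite /= ltn_ord.
have E k : (1 <= k <= 2 * n)%N ->
   rowop a1 b1 a2 b2 t (fun r' => Mentry p z r' k) r.+1 =
   row_entry p z w (rowop a1 b1 a2 b2 t (Mcol1 p) r.+1)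
     (fun k => rowop a1 b1 a2 b2 t (@kdelta R ^~ k) r.+1) k.
  by move=> hk; rewrite row_entry_rowop /rowop !Mentry_row_entry.
by rewrite !E // -H // Mentry_row_entry // lv.
Qed.

Lemma Gmat_affine (t : R) : Gmat n 0 t = shear (2 * n) (2 * n - 1) 1 (2 * n) 2 t.
Proof. by []. Qed.

Lemma Gmat_mid i (t : R) : (1 <= i <= n - 1)%N ->
  Gmat n i t = shear (2 * n) i i.+1 (2 * n - i) (2 * n + 1 - i) t.
Proof. by move=> hi; rewrite /Gmat ifF ?ifT //; index_lia. Qed.

Lemma Gmat_final (t : R) : Gmat n n t = shear (2 * n) (n - 1) (n + 1) n (n + 2) t.
Proof. by rewrite /Gmat !ifF //; index_lia. Qed.

Lemma GmatD i (t u : R) : (i <= n)%N -> Gmat n i t *m Gmat n i u = Gmat n i (t + u).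
Proof.
move=> hi; case: (posnP i) => [->|i0]; first by rewrite !Gmat_affine shearD //; index_lia.
case: (eqVneq i n) => [->|hin]; first by rewrite !Gmat_final shearD //; index_lia.
by rewrite !Gmat_mid ?shearD //; index_lia.
Qed.

(** * The identity for one factor *)

Theorem Mmat_e_act i c p z : (i <= n)%N ->
  Mmat_defined p -> Mmat_defined (e_act i c p) -> e_act_defined i c p ->
  z ^+ (i == 0%N) != 0 ->
  Mmat (e_act i c p) z =
    Gmat n i ((c - 1) / (z ^+ (i == 0%N) * eps i p)) *m Mmat p z
    *m Gmat n i ((c^-1 - 1) / (z ^+ (i == 0%N) * phi i p)).
Proof.
move=> hi hp hq [c0 he] z0.
have xi_neq0 k : xc p k + xb p k != 0 -> xi c p k != 0 -> xc p k + c * xb p k != 0.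
  by move=> h; apply: contraNneq => h0; rewrite /xi h0 mul0r.
case: i hi hq he z0 => [|i] hi hq he z0.
  have [nz1 nz2] := he isT; have nz3 := xi_neq0 _ nz1 nz2.
  rewrite !Gmat_affine /eps /phi eqxx expr1 in z0 *.
  set t := (c - 1) / _; set u := (c^-1 - 1) / _.
  have S r hr := @first_column_affine p z t u c r hp c0 z0 nz1 nz3 erefl erefl hr.
  have [lv _] := S 1%N ltac:(index_lia).
  apply: Mmat_shear => //; try index_lia; move=> r j hr hj s e.
  have [_ Sr] := S r hr.
  rewrite (row_entry_affine (p := p) (z := z) (s := s) (a := t) (b := u) (e := e) hp c0 z0 nz1
      nz3) //.
    by move=> k; rewrite /e rowop_kdelta.
  rewrite Sr -/s row_entry_high /=; last by index_lia.
  have eK k : (2 < k)%N -> e k = kdelta r k.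
    move=> hk; rewrite /e rowop_kdelta; have -> : (k == 1)%N = false by index_lia.
    by have -> : (k == 2)%N = false by [index_lia]; rewrite !mulr0n !mul0r addr0 mulr0 addr0.
  by rewrite subn0 !eK //; index_lia.
case: (ltnP i (n - 2)) => hi2.
  have [|nz1 nz2] := he; first by index_lia.
  have nz3 := xi_neq0 _ nz1 nz2.
  rewrite !Gmat_mid ?expr0 ?mul1r; try index_lia.
  rewrite /eps /phi /= (_ : (i < n - 2)%N = true) //.
  have -> : (2 * n + 1 - i.+1 = 2 * n - i)%N by index_lia.
  set t := (c - 1) / _; set u := (c^-1 - 1) / _.
  have S r hr := @first_column_mid i p t c r hi2 hp c0 nz1 nz3 erefl hr.
  have [lv _] := S 1%N ltac:(index_lia).
  apply: Mmat_shear => //; try index_lia; move=> r j hr hj s e.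
  have [_ Sr] := S r hr.
  rewrite Sr; apply: row_entry_mid => // k; exact: rowop_kdelta.
case: (eqVneq i.+1 (n - 1)%N) => hi3.
  rewrite hi3 in hq *.
  rewrite !Gmat_mid ?expr0 ?mul1r; try index_lia.
  have e0 : (n - 1 == 0)%N = false by index_lia.
  have e1 : (n - 1 <= n - 2)%N = false by index_lia.
  rewrite /eps /phi e0 e1 eqxx expr0 !mul1r.
  have -> : (n - 1).+1 = n by index_lia.
  have -> : (2 * n - (n - 1) = n + 1)%N by index_lia.
  have -> : (2 * n + 1 - (n - 1) = n + 2)%N by index_lia.
  set t := (c - 1) / _; set u := (c^-1 - 1) / _.
  have S r hr := @first_column_penult p t c r hp c0 erefl hr.
  have [lv _] := S 1%N ltac:(index_lia).
  apply: Mmat_shear => //; try index_lia; move=> r j hr hj s e.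
  have [_ Sr] := S r hr.
  rewrite Sr; apply: row_entry_penult => //; first by move=> k; exact: rowop_kdelta.
  by apply: hinge_rowop => //; index_lia.
have hin : i.+1 = n by index_lia.
rewrite hin in hq *; rewrite !Gmat_final.
have e0 : (n == 0)%N = false by index_lia.
have e1 : (n <= n - 2)%N = false by index_lia.
have e2 : (n == n - 1)%N = false by index_lia.
rewrite /eps /phi e0 e1 e2 expr0 !mul1r.
set t := (c - 1) / _; set u := (c^-1 - 1) / _.
have S r hr := @first_column_final p t c r hp c0 erefl hr.
have [lv _] := S 1%N ltac:(index_lia).
apply: Mmat_shear => //; try index_lia; move=> r j hr hj s e.
have [_ Sr] := S r hr.
rewrite Sr; apply: row_entry_final => //; first by move=> k; exact: rowop_kdelta.
by apply: hinge_rowop => //; index_lia.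
Qed.
End SingleFactor.

(** * The product crystal *)

Lemma mulmx_telescope (R : fieldType) m L (F F' u v : 'I_L.+1 -> 'M[R]_m) :
  (forall l, F' l = u l *m F l *m v l) ->
  (forall l l' : 'I_L.+1, l' = l.+1 :> nat -> v l *m u l' = 1%:M) ->
  \big[mulmx/1%:M]_(l < L.+1) F' l
  = u ord0 *m \big[mulmx/1%:M]_(l < L.+1) F l *m v ord_max.
Proof.
elim: L F F' u v => [|L IH] F F' u v hF huv.
  by rewrite !big_ord_recl !big_ord0 !mulmx1 hF (ord1 ord_max).
rewrite big_ord_recl [in RHS]big_ord_recl.
rewrite (IH (F \o lift ord0) _ (u \o lift ord0) (v \o lift ord0)); last 2 first.
- by move=> l; apply: hF.
- by move=> l l' h; apply: huv; rewrite /= /bump h.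
have -> : (v \o lift ord0) ord_max = v ord_max by congr v; apply: val_inj.
by rewrite hF /= -!mulmxA (mulmxA (v ord0)) huv ?mul1mx.
Qed.

Section ProductCrystal.
Variables (R : fieldType) (n L i : nat) (c : R) (x : 'I_L.+1 -> crystal R n).
Implicit Types l k j : 'I_L.+1.
Local Notation ep j := (eps i (x j)).
Local Notation ph j := (phi i (x j)).

(** The summand common to [eps_prod], [phi_prod] and the factors c_l; the first
    two are normalised by its value at the first and at the last position. *)
Definition pathterm k : R :=
  (\prod_(j < L.+1 | (0 < j <= k)%N) ep j) *
  (\prod_(j < L.+1 | (k <= j)%N && (j.+1 < L.+1)%N) ph j).

(** Passing from k to k+1 trades phi_i(x^k) for eps_i(x^(k+1)); this is what
    makes neighbouring matrices cancel. *)
Lemma pathterm_step l l' : l' = l.+1 :> nat ->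
  pathterm l * ep l' = pathterm l' * ph l.
Proof.
move=> hl; rewrite /pathterm (bigD1 (P := fun j => (0 < j <= l')%N) l') /=; last by rewrite hl
    leqnn.
rewrite (bigD1 (P := fun j => (l <= j)%N && _) l) /=; last by rewrite leqnn -hl ltn_ord.
have -> : \prod_(j < L.+1 | (0 < j <= l')%N && (j != l')) ep j
    = \prod_(j < L.+1 | (0 < j <= l)%N) ep j.
  by apply: eq_bigl => j; rewrite -(inj_eq val_inj) /= hl; lia.
have -> : \prod_(j < L.+1 | (l <= j)%N && (j.+1 < L.+1)%N && (j != l)) ph j
    = \prod_(j < L.+1 | (l' <= j)%N && (j.+1 < L.+1)%N) ph j.
  by apply: eq_bigl => j; rewrite -(inj_eq val_inj) /= hl; lia.
by ring.
Qed.

Lemma cfactor_numE l : cfactor_num i c x l = \sum_(k < L.+1) c ^+ (k <= l)%N * pathterm k.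
Proof. by apply: eq_bigr => k _; rewrite mulrA. Qed.

Lemma cfactor_denE l : cfactor_den i c x l = \sum_(k < L.+1) c ^+ (k < l)%N * pathterm k.
Proof. by apply: eq_bigr => k _; rewrite mulrA. Qed.

Lemma cfactor_num_next l l' : l' = l.+1 :> nat ->
  cfactor_num i c x l = cfactor_den i c x l'.
Proof.
by move=> hl; rewrite cfactor_numE cfactor_denE hl; apply: eq_bigr => k _; rewrite ltnS.
Qed.

Lemma cfactor_jump l :
  cfactor_num i c x l - cfactor_den i c x l = (c - 1) * pathterm l.
Proof.
rewrite cfactor_numE cfactor_denE -sumrB (bigD1 l) //= leqnn ltnn big1 ?addr0.
  by rewrite expr1 expr0 -mulrBl.
move=> k; rewrite -(inj_eq val_inj) /= => hk.
by have -> : (k <= l)%N = (k < l)%N by [lia]; rewrite subrr.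
Qed.

Lemma cfactor_den0 : cfactor_den i c x ord0 = \sum_k pathterm k.
Proof. by rewrite cfactor_denE; apply: eq_bigr => k _; rewrite expr0 mul1r. Qed.

Lemma cfactor_num_max : cfactor_num i c x ord_max = c * \sum_k pathterm k.
Proof.
by rewrite cfactor_numE mulr_sumr; apply: eq_bigr => k _; rewrite -ltnS ltn_ord expr1.
Qed.

Lemma eps_prodE : eps_prod i x = ep ord0 * (\sum_k pathterm k) / pathterm ord0.
Proof.
rewrite /eps_prod; congr (_ / _); last first.
  by rewrite /pathterm [X in _ = X * _]big_pred0 ?mul1r // => j /=; lia.
rewrite mulr_sumr; apply: eq_bigr => k _.
rewrite (bigD1 ord0) //= /pathterm !mulrA; congr (_ * _ * _).
by apply: eq_bigl => j; rewrite -(inj_eq val_inj) /=; lia.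
Qed.

Lemma phi_prodE : phi_prod i x = ph ord_max * (\sum_k pathterm k) / pathterm ord_max.
Proof.
rewrite /phi_prod; congr (_ / _); last first.
  rewrite /pathterm [X in _ = _ * X]big_pred0 ?mulr1.
    by apply: eq_bigl => j; have := ltn_ord j; rewrite /=; lia.
  by move=> j /=; lia.
rewrite mulr_sumr; apply: eq_bigr => k _.
rewrite (bigD1 (P := fun j => (k <= j)%N) ord_max) /=; last by rewrite -ltnS ltn_ord.
rewrite /pathterm mulrCA; congr (_ * (_ * _)).
by apply: eq_bigl => j; have := ltn_ord j; rewrite -(inj_eq val_inj) /=; lia.
Qed.

End ProductCrystal.

Theorem theorem3p12 (R : realType) (n : nat) (hn : (4 <= n)%N)
    (L : nat) (hL : (1 <= L)%N) (x : 'I_L -> crystal R n) (c z : R)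
    (i : nat) (hi : (i <= n)%N)
    (hlhs : lhs_defined i c x) (hrhs : rhs_defined i c z x) :
  Mprod (e_prod i c x) z =
    Gmat n i ((c - 1) / (z ^+ (i == 0%N) * eps_prod i x))
    *m Mprod x z
    *m Gmat n i ((c^-1 - 1) / (z ^+ (i == 0%N) * phi_prod i x)).
Proof.
case: L hL x hlhs hrhs => // L _ x hlhs [hx c0 [hph hep] heps hphi].
set Z := z ^+ _ in heps hphi *.
have Z0 : Z != 0 by apply: contraNneq heps => ->; rewrite mul0r.
set S := \sum_k pathterm i x k.
pose C l := cfactor i c x l.
have D0 l : cfactor_den i c x l != 0 by have [] := hlhs l.
have C0 l : C l != 0 by have [_ [] ] := hlhs l.
have N0 l : cfactor_num i c x l != 0.
  by apply: contraNneq (C0 l) => h; rewrite /C /cfactor h mul0r.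
have S0 : S != 0 by move: (D0 ord0); rewrite cfactor_den0.
(* eps_i(x^1) and phi_i(x^L) divide the quantities eps_prod and phi_prod, so *)
(* they are nonzero as well; the inner values are covered by the products.    *)
have E0 : eps i (x ord0) != 0 /\ pathterm i x ord0 != 0.
  move: heps; rewrite eps_prodE -/S => h; split; apply: contraNneq h => ->.
    by rewrite !mul0r mulr0.
  by rewrite invr0 !mulr0.
have P0 : phi i (x ord_max) != 0 /\ pathterm i x ord_max != 0.
  move: hphi; rewrite phi_prodE -/S => h; split; apply: contraNneq h => ->.
    by rewrite !mul0r mulr0.
  by rewrite invr0 !mulr0.
(* The arguments of the matrices to the left and right of the l-th factor. *)
pose a l := (C l - 1) / (Z * eps i (x l)).
pose b l := ((C l)^-1 - 1) / (Z * phi i (x l)).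
have C1 l : C l - 1 = (c - 1) * pathterm i x l / cfactor_den i c x l.
  by rewrite -cfactor_jump /C /cfactor; field; exact: D0.
have C2 l : (C l)^-1 - 1 = - ((c - 1) * pathterm i x l / cfactor_num i c x l).
  by rewrite -cfactor_jump /C /cfactor; field; rewrite ?N0 ?D0.
rewrite (_ : (c - 1) / (Z * eps_prod i x) = a ord0); last first.
  have [e0 t0] := E0.
  rewrite /a C1 eps_prodE cfactor_den0 -/S; field.
  by rewrite e0 t0 S0 Z0.
rewrite (_ : (c^-1 - 1) / (Z * phi_prod i x) = b ord_max); last first.
  have [f0 t0] := P0.
  rewrite /b C2 phi_prodE cfactor_num_max -/S; field.
  by rewrite f0 t0 S0 Z0 c0.
apply: (@mulmx_telescope _ _ _ _ _ (fun l => Gmat n i (a l)) (fun l => Gmat n i (b l))) => [l|l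
    l' hl].
  have [_ h1 h2] := hlhs l.
  exact: Mmat_e_act.
have e0 : eps i (x l') != 0.
  have hl' : (0 < l')%N by rewrite hl.
  by move/prodf_neq0: hep; apply.
have f0 : phi i (x l) != 0.
  have hl' : (l.+1 < L.+1)%N by rewrite -hl ltn_ord.
  by move/prodf_neq0: hph; apply.
rewrite GmatD //.
have -> : b l + a l' = 0; last by rewrite /Gmat !scale0r !addr0 !if_same.
have ct : pathterm i x l' = pathterm i x l * eps i (x l') / phi i (x l).
  by rewrite (pathterm_step i x hl) mulfK.
rewrite /a /b C1 C2 (cfactor_num_next i c x hl) ct; field.
by rewrite e0 f0 Z0 D0.
Qed.
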